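(* Let $n\ge2$, $c\in\mathbb{H}^n$, $r>0$, and $\Omega=B^*(c,r)=B(c,r)\setminus\{c\}\subset\mathbb{H}^n$. Let $u\in C^0(\overline{\Omega})\cap C^2(\Omega)$ be such that $\Gamma_u$ is a space-like translator over $\Omega$, with a possible singularity at $c$, and $u$ is constant on $\partial B(c,r)$. Then $\Gamma_u$ is rotationally invariant (about $c$). In addition, if $u\in C^2(B(c,r))$, then $\Gamma_u$ is a compact piece of the bowl.
   Context: $\mathbb{H}^n$ is hyperbolic space with its metric $g_{\mathbb{H}^n}$, and the ambient space is $\mathbb{H}^n\times\mathbb{R}$ with the Lorentzian metric $g_{\mathbb{H}^n}-dt^2$. $B(c,r)$ is the hyperbolic ball of center $c$ and radius $r$. For $u\in C^2(\Omega)$, the graph $\Gamma_u(p)=(p,u(p))$ is space-like if $|\nabla u|<1$ on $\Omega$ (gradient, norm and divergence with respect to $g_{\mathbb{H}^n}$). A space-like graph is a translator if its mean curvature vector (trace of the second fundamental form) equals $\partial_t^\perp$, the normal projection of $\partial_t$; equivalently, on $\Omega$, $$\mathrm{div}\left(\frac{\nabla u}{\sqrt{1-|\nabla u|^2}}\right)=\frac{1}{\sqrt{1-|\nabla u|^2}}.$$ Rotationally invariant about $c$ means that $u(p)$ depends only on the hyperbolic distance $\tau_c(p)=d(c,p)$. The bowl (with axis through $c$): let $\hat w:[0,+\infty)\to(-1,1)$ be the unique continuous function with $\hat w(0)=0$ solving $w'(s)=(1-w(s)^2)(1-(n-1)\coth(s)w(s))$ on $(0,+\infty)$, and let $\hat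 f(s)=\int\hat w(s)\,ds+f_0$, $f_0\in\mathbb{R}$. The bowl is the graph of $\hat f\circ\tau_c$. ''Compact piece'' means that $u=\hat f\circ\tau_c$ on the closed ball $\overline{B(c,r)}$ for some choice of $f_0$. *)

(* Defs.v *)
From HB Require Import structures.
From mathcomp Require Import all_boot all_order all_algebra.
From mathcomp Require Import all_classical all_reals all_analysis.
Set Implicit Arguments.
Unset Strict Implicit.
Unset Printing Implicit Defensive.
Import Order.TTheory GRing.Theory Num.Theory.
Import numFieldNormedType.Exports.
Local Open Scope classical_set_scope.
Local Open Scope ring_scope.

(* Hyperbolic space is the hyperboloid {<p,p> = -1, p_0 > 0} of Minkowski space
   R^(n+1), whose form has signature (-,+,...,+); coordinate 0 is the time
   coordinate.  Functions on (subsets of) H^n are represented by functions on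
   R^(n+1), of which only the values on H^n matter. *)
Section Hyperboloid.
Context {R : realType} {n : nat}.
Implicit Types (p q x y : 'rV[R]_n.+1) (u : 'rV[R]_n.+1 -> R).

Definition lsign (i : 'I_n.+1) : R := if i == ord0 then -1 else 1.

Definition lform x y : R := \sum_(i < n.+1) lsign i * x 0 i * y 0 i.

Definition hyp : set 'rV[R]_n.+1 :=
  [set p | lform p p = -1 /\ 0 < p 0 ord0].

Definition arcosh (a : R) : R := ln (a + Num.sqrt (a ^+ 2 - 1)).

Definition hdist p q : R := arcosh (- lform p q).

Definition hball c r : set 'rV[R]_n.+1 := [set p | hyp p /\ hdist c p < r].

Definition hsphere c r : set 'rV[R]_n.+1 := [set p | hyp p /\ hdist c p = r].

Definition hball_star c r : set 'rV[R]_n.+1 := hball c r `\ c.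

(* Radial projection of the open future cone onto the hyperboloid.  If
   <x,x> >= 0 then [Num.sqrt] and the inverse return 0, hence so does [hproj],
   and 0 is not in [hyp]; the past cone is sent to the past sheet.  Thus
   [hproj @^-1` A] is the open cone over A, for A included in [hyp]. *)
Definition hproj x : 'rV[R]_n.+1 := (Num.sqrt (- lform x x))^-1 *: x.

(* Extension to the cone, constant along rays from the origin. *)
Definition hext (T : Type) (f : 'rV[R]_n.+1 -> T) : 'rV[R]_n.+1 -> T :=
  f \o hproj.

Definition basis_vec (i : 'I_n.+1) : 'rV[R]_n.+1 := delta_mx 0 i.

Definition pderiv (i : 'I_n.+1) (f : 'rV[R]_n.+1 -> R) x : R :=
  'D_(basis_vec i) f x.

(* For U open. *)
Definition C1_flat (U : set 'rV[R]_n.+1) (f : 'rV[R]_n.+1 -> R) : Prop :=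
  forall x, U x -> forall i,
    derivable f x (basis_vec i) /\ {for x, continuous (pderiv i f)}.

Definition C2_flat (U : set 'rV[R]_n.+1) (f : 'rV[R]_n.+1 -> R) : Prop :=
  C1_flat U f /\ forall i, C1_flat U (pderiv i f).

(* x |-> (hproj x, <x,x>) is a diffeomorphism from the open cone over A to
   A x ]-oo, 0[, so u is C^2 on A, open in H^n, iff [hext u] is C^2 on the
   cone. *)
Definition C2_on (A : set 'rV[R]_n.+1) u : Prop :=
  C2_flat (hproj @^-1` A) (hext u).

(* The derivative of [hext u] at p vanishes on p, the normal direction to H^n,
   so its Minkowski dual is tangent to H^n: it is the gradient of u for the
   metric induced on H^n. *)
Definition hgrad u p : 'rV[R]_n.+1 := \row_i (lsign i * pderiv i (hext u) p).

Definition hgrad_normsq u p : R := lform (hgrad u p) (hgrad u p).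

(* For V tangent to H^n.  The derivative of [hext V] at p vanishes on p, so its
   flat trace is the trace over T_p H^n of the tangential part of the flat
   derivative, which is the Levi-Civita derivative of V. *)
Definition hdiv (V : 'rV[R]_n.+1 -> 'rV[R]_n.+1) p : R :=
  \sum_(i < n.+1) pderiv i (fun x => hext V x 0 i) p.

(* |grad u| < 1; the induced norm on tangent vectors is nonnegative, so this is
   stated on its square. *)
Definition spacelike_graph (A : set 'rV[R]_n.+1) u : Prop :=
  forall p, A p -> hgrad_normsq u p < 1.

Definition graph_W u p : R := Num.sqrt (1 - hgrad_normsq u p).

Definition spacelike_translator (A : set 'rV[R]_n.+1) u : Prop :=
  spacelike_graph A u /\
  forall p, A p ->
    hdiv (fun q => (graph_W u q)^-1 *: hgrad u q) p = (graph_W u p)^-1.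

Definition rotationally_invariant c (A : set 'rV[R]_n.+1) u : Prop :=
  exists phi : R -> R, forall p, A p -> u p = phi (hdist c p).

End Hyperboloid.

Definition coth {R : realType} (s : R) : R :=
  (expR s + expR (- s)) / (expR s - expR (- s)).

Definition bowl_profile {R : realType} (n : nat) (w : R -> R) : Prop :=
  [/\ {within `[0, +oo[, continuous w},
      (forall s, 0 <= s -> -1 < w s < 1),
      w 0 = 0 &
      forall s : R, 0 < s ->
        is_derive s 1 w ((1 - w s ^+ 2) * (1 - (n%:R - 1) * coth s * w s))].

Definition bowl_fun {R : realType} (w : R -> R) (f0 s : R) : R :=
  (\int[lebesgue_measure]_(t in `[0, s]) w t) + f0.

(* Main.v *)
(* Any two points of the punctured ball at the same distance from c are
   exchanged by a Lorentz reflection fixing c, so rotational symmetry is the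
   equality of u with its reflections: both are translators with the same values
   on the sphere and at c, and a maximum principle forces them to coincide.  The
   translator equation has no zeroth order term, hence it needs strictness:
   u + e exp (a u), for a large and e small, is a strict subsolution on compact
   sets, because the right-hand side of the equation does not vanish at the
   critical points of u and the Hessian terms are controlled by |grad u|^2
   elsewhere.  All derivatives are flat derivatives of degree 0 homogeneous
   extensions to the cone, so the second derivative test along straight lines
   replaces Riemannian Hessians.

   If u is also C^2 at c, its radial derivative vanishes at c by symmetry and
   solves the ODE of the bowl; uniqueness holds because the squared difference
   of the inverse hyperbolic tangents of two solutions is nonincreasing. *)
From HB Require Import structures.
Require Import Defs.
From mathcomp Require Import all_boot all_order all_algebra.
From mathcomp Require Import all_classical all_reals all_analysis.
From mathcomp Require Import ring lra.
Import Order.TTheory GRing.Theory Num.Theory.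
Import numFieldNormedType.Exports.
Local Open Scope classical_set_scope.
Local Open Scope ring_scope.
Set Implicit Arguments.
Unset Strict Implicit.
Unset Printing Implicit Defensive.

(** At a maximum point of [u1 + e exp (a u1) - u2] the gradients satisfy [g2 = (1 + d) g1] and the
    Hessians [(1 + d) B1 + a d g1 g1^T <= B2], with [d = a e exp (a u1)]. Inserted into the two
    equations, everything of order zero in [d] cancels, and division by [d] leaves [(1 - N) (1 - (1
    + d)^2 N) + a N (1 - N) + (1 + d) (2 + d) Q <= 0], where [N = |grad u1|^2] and
    [Q = Hess u1 (grad u1, grad u1)]. The first term is positive because the second graph is
    space-like at that very point. The obstacle is [Q], which has no sign: on a compact set
    [|Q| <= C N (1 - N)], and [(1 + d) (2 + d) <= 6] as soon as [d <= 1], whence [a = 6 C]. Since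
    [C] must not depend on [e], the compact set is a superlevel set of [u1 - u2], fixed before [e]
    is chosen. Tangential objects at [p] are computed in Lorentz frames with time vector [p]: there
    the inverse metric of the tangent space is a sum of squares, and a degree 0 extension has no
    derivative along [p]. *)

Section PartialDerivatives.
Context {R : realType}.

(** * From continuous partial derivatives to the differential *)

Lemma is_derive_line n (F : 'rV[R]_n -> R) (x v : 'rV[R]_n) (t : R) :
  derivable F (x + t *: v) v ->
  is_derive t 1 (fun s => F (x + s *: v)) ('D_v F (x + t *: v)).
Proof.
move=> dF.
have E : (fun h : R => h^-1 *: (F (x + (h *: (1 : R) + t) *: v) - F (x + t *: v)))
   = (fun h : R => h^-1 *: (F (h *: v + (x + t *: v)) - F (x + t *: v))).
  apply/funext => h; congr (_ *: (F _ - _)).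
  by rewrite -[h *: (1 : R)]/(h * 1) mulr1 scalerDl addrCA.
by split; rewrite /derivable /derive /= ?E.
Qed.

Definition partial_grad n (F : 'rV[R]_n -> R) (x : 'rV[R]_n) : 'cV[R]_n :=
  \col_i 'D_(delta_mx 0 i) F x.

Lemma differentiable_of_estimate (V W : normedModType R) (f : V -> W)
    (df : {linear V -> W}) (x : V) :
  continuous df ->
  (forall e, 0 < e ->
    \forall v \near 0, `|f (v + x) - (f x + df v)| <= e * `|v|) ->
  differentiable f x /\ 'd f x = df :> (V -> W).
Proof.
move=> cdf H.
have key : f \o shift x = cst (f x) + df +o_ 0 id by apply/eqaddoP => e; exact: H.
have dE := diff_unique cdf key.
by split => //; apply/diff_locallyP; split; rewrite dE.
Qed.

Definition colform n (w : 'cV[R]_n) (v : 'rV[R]_n) : R := (v *m w) 0 0.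

Lemma colform_is_linear n (w : 'cV[R]_n) : linear (colform w).
Proof. by move=> a u v; rewrite /colform mulmxDl -scalemxAl !mxE. Qed.

HB.instance Definition _ n (w : 'cV[R]_n) :=
  GRing.isLinear.Build R 'rV[R]_n R _ (colform w) (colform_is_linear w).

Lemma colform_continuous n (w : 'cV[R]_n) : continuous (colform w).
Proof.
rewrite (_ : colform w = fun v : 'rV[R]_n => \sum_i v 0 i * w i 0); last first.
  by apply/funext => y; rewrite /colform mxE.
apply: continuous_big => [|i _ v]; first exact: add_continuous.
by apply: continuousM; [exact: coord_continuous|exact: cst_continuous].
Qed.

(** The points [x + trunc v k] are the vertices of a path from [x] to [x + v] that changes one
    coordinate at a time. *)
Let trunc n (v : 'rV[R]_n) (k : nat) : 'rV[R]_n :=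
  \row_i (if (i < k)%N then v 0 i else 0).

Lemma trunc_S n (v : 'rV[R]_n) (k : 'I_n) :
  trunc v k.+1 = trunc v k + v 0 k *: delta_mx 0 k.
Proof.
apply/rowP => i; rewrite !mxE eqxx /= ltnS leq_eqVlt.
have [->|ik] := eqVneq i k; first by rewrite eqxx ltnn /= mulr1 add0r.
by rewrite (_ : (i == k :> nat) = false) ?mulr0 ?addr0 //;
  apply/eqP => /val_inj /eqP; rewrite (negPf ik).
Qed.

(** [C2_flat] speaks of partial derivatives only, whereas differentiation along geodesics and
    circles needs the total differential. The increment is telescoped along the coordinate path,
    with the mean value theorem on each edge. *)
Lemma differentiable_of_partials n (F : 'rV[R]_n -> R) (x : 'rV[R]_n) (U : set 'rV[R]_n) :
  nbhs x U -> (forall y i, U y -> derivable F y (delta_mx 0 i)) ->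
  (forall i, {for x, continuous (fun y => 'D_(delta_mx 0 i) F y)}) ->
  differentiable F x /\ forall v, 'd F x v = colform (partial_grad F x) v.
Proof.
move=> xU derF cF.
suff H : forall e, 0 < e -> \forall v \near (0 : 'rV[R]_n),
    `|F (v + x) - (F x + colform (partial_grad F x) v)| <= e * `|v|.
  have [? E] := @differentiable_of_estimate _ _ F (colform (partial_grad F x)) x
    (@colform_continuous _ _) H.
  by split=> // v; rewrite E.
move=> _/posnumP[e].
  (* The tolerance is split into [n.+1] parts rather than [n], so that it stays positive in
     dimension 0. *)
  have n0 : 0 < n.+1%:R :> R by rewrite ltr0n.
  have cF' : nbhs x [set y | forall i : 'I_n,
     `|'D_(delta_mx 0 i) F x - 'D_(delta_mx 0 i) F y| < e%:num / n.+1%:R].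
    have FF : Filter (nbhs x) by exact: nbhs_filter.
    refine (@filter_forall _ _ (fun (i : 'I_n) y =>
      `|'D_(delta_mx 0 i) F x - 'D_(delta_mx 0 i) F y| < e%:num / n.+1%:R) (nbhs x) FF _) => i.
    by have /cvgrPdist_lt := cF i; apply; rewrite divr_gt0.
have [d /= d0 dP] := (nbhs_ballP x _).1 (filterI xU cF').
  apply/nbhs_ballP; exists d => // v.
  rewrite -[ball 0 d v]/(ball (0:'rV[R]_n) d v) -ball_normE /ball_ /= sub0r normrN => vd.
  have vi i : `|v 0 i| <= `|v|.
    by rewrite [leRHS]/Num.Def.normr /= mx_normrE; apply/(le_trans _ (le_bigmax _ _ (0, i))).
  have -> : F (v + x) - (F x + colform (partial_grad F x) v) =
     \sum_(i < n) (F (x + trunc v i.+1) - F (x + trunc v i) - v 0 i * 'D_(delta_mx 0 i) F x).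
    rewrite sumrB opprD addrA; congr (_ - _); last first.
      by rewrite /colform mxE; apply: eq_bigr => i _; rewrite mxE.
    rewrite -(big_mkord xpredT (fun i => F (x + trunc v i.+1) - F (x + trunc v i))).
    rewrite telescope_sumr //; congr (F _ - F _).
      by rewrite addrC; congr (_ + _); apply/rowP => i; rewrite !mxE ltn_ord.
    by rewrite -[LHS]addr0; congr (_ + _); apply/rowP => i; rewrite !mxE.
  apply: (@le_trans _ _ (\sum_(i < n) e%:num / n.+1%:R * `|v|)); last first.
    rewrite sumr_const card_ord -[_ *+ n]mulr_natr mulrAC; apply: ler_wpM2r => //.
    by rewrite -mulrA ger_pMr // mulrC ler_pdivrMr // mul1r ler_nat.
  apply: le_trans (ler_norm_sum _ _ _) _; apply: ler_sum => i _.
  have inb (t : R) : t \in `[0, 1] -> ball x d (x + trunc v i + (t * v 0 i) *: delta_mx 0 i).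
    rewrite in_itv /= => /andP[t0 t1].
    rewrite -ball_normE /ball_ /= -addrA opprD addrA subrr sub0r normrN.
    apply: le_lt_trans vd; rewrite [leLHS]/Num.Def.normr /= mx_normrE.
    apply: bigmax_le => // -[j k] _ /=; rewrite ord1 !mxE /=.
    have [->|ki] := eqVneq k i.
      rewrite ltnn add0r mulr1 normrM ger0_norm //.
      by apply: le_trans (vi i); rewrite ler_piMl.
    by rewrite mulr0 addr0; case: ifP => _; rewrite ?vi // normr0.
  have dl (t : R) : t \in `[0, 1] -> is_derive t 1
      (fun s => F (x + trunc v i + (s * v 0 i) *: delta_mx 0 i))
      (v 0 i * 'D_(delta_mx 0 i) F (x + trunc v i + (t * v 0 i) *: delta_mx 0 i)).
    move=> t01; have [/derF D _] := dP _ (inb _ t01).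
    have h1 := is_derive_line (D i).
    have h2 : is_derive t 1 (fun s : R => s * v 0 i) (v 0 i).
      by apply: is_derive_eq; rewrite scaler0 add0r -[LHS]/(_ * 1) mulr1.
    have := @is_derive1_comp _ (fun s => F (x + trunc v i + s *: delta_mx 0 i))
      _ t _ _ h1 h2.
    by rewrite mulrC.
  have [|c c01 /=] := MVT (ltr01 : 0 < 1 :> R) (fun t ht => dl t (subset_itv_oo_cc ht)).
    apply: derivable_within_continuous => t t01; by have [] := dl t t01.
  rewrite mul0r scale0r addr0 mul1r subr0 mulr1 -addrA -trunc_S => ->.
  rewrite -mulrBr normrM mulrC ler_pM // distrC.
  by have [_ /(_ i)/ltW] := dP _ (inb _ (subset_itv_oo_cc c01)).
Qed.

Lemma is_derive_chain n (F : 'rV[R]_n -> R) (g : R -> 'rV[R]_n) (t : R) (dg : 'rV[R]_n) :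
  differentiable F (g t) ->
  (forall i, is_derive t 1 (fun s => g s 0 i) (dg 0 i)) ->
  is_derive t 1 (F \o g) ('d F (g t) dg).
Proof.
move=> dF dgi.
have gd : derivable g t 1.
  by apply/derivable_mxP => i j; rewrite ord1; apply: ex_derive.
have gE : 'D_1 g t = dg.
  rewrite derive_mx //; apply/rowP => i; rewrite mxE.
  by have h := dgi i; apply: derive_val.
have gdf : differentiable g t by apply/derivable1_diffP.
have Fg : differentiable (F \o g) t by apply: differentiable_comp.
apply: DeriveDef; first exact: diff_derivable.
by rewrite deriveE // diff_comp //= -(deriveE _ gdf) gE.
Qed.

End PartialDerivatives.

(** * Second derivative test in one variable *)

Section SecondDerivativeTest.
Context {R : realType}.

(** If [b > 0], then [f'], which vanishes at 0, is positive just to the right of 0, and the mean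
    value theorem produces a value of [f] above the maximum. *)
Lemma second_derivative_test (f f' : R -> R) (b e : R) :
  0 < e -> (forall t : R, `|t| < e -> is_derive t 1 f (f' t)) ->
  is_derive (0 : R) 1 f' b -> (forall t, `|t| < e -> f t <= f 0) ->
  f' 0 = 0 /\ b <= 0.
Proof.
move=> e0 df df' fmax.
have f'0 : f' 0 = 0.
  have Hd t : t \in `]-e, e[ -> derivable f t 1.
    by rewrite in_itv /= -ltr_norml => /df [].
  have := @derive1_at_max R f (-e) e 0 _ Hd _ _.
  have d0 : is_derive (0 : R) 1 f (f' 0) by apply: df; rewrite normr0.
  move=> H; have {}H : is_derive (0 : R) 1 f 0.
    apply: H; first by rewrite (le_trans _ (ltW e0)) // oppr_le0 ltW.
      by rewrite in_itv /= oppr_lt0 e0.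
    by move=> t; rewrite in_itv /= -ltr_norml; exact: fmax.
  by case: d0 H => _ <- [_ ->].
split=> //; rewrite leNgt; apply/negP => b0.
have [df'0 /= Df'] := df'.
have /cvgrPdist_lt /(_ b b0) : (h^-1 *: (f' (h *: (1 : R) + 0) - f' 0)) @[h --> (0 : R)^'] --> b.
  by move: (df'0); rewrite /derivable /= => /cvgP; rewrite -Df' => H; exact: H.
rewrite near_withinE => /nbhs_ballP [d /= d0 dP].
have dpos t : 0 < t -> t < d -> 0 < f' t.
  move=> t0 td; have := dP t; rewrite -ball_normE /= sub0r normrN gtr0_norm //.
  move=> /(_ td (lt0r_neq0 t0)).
  rewrite f'0 subr0 addr0 -[t *: 1]/(t * 1) mulr1 -[_ *: f' t]/(_ * f' t) => H.
  have : 0 < t^-1 * f' t by move: H; rewrite ltr_norml; lra.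
  by rewrite pmulr_rgt0 // invr_gt0.
pose h := Num.min d e / 2.
have m0 : 0 < Num.min d e by rewrite lt_min d0.
have h0 : 0 < h by rewrite /h divr_gt0.
have hm : h < Num.min d e by rewrite /h ltr_pdivrMr // mulr_natr mulr2n ltrDl.
have [hd he] : h < d /\ h < e by move: hm; rewrite lt_min => /andP.
have dh (t : R) : 0 <= t <= h -> is_derive t 1 f (f' t).
  by move=> /andP[t0 th]; apply: df; rewrite ger0_norm // (le_lt_trans th).
have [||c] := @MVT R f f' 0 h h0.
- by move=> t; rewrite in_itv /= => /andP[t0 th]; apply: dh; rewrite !ltW.
- apply: derivable_within_continuous => t; rewrite in_itv /= => ht.
  by have [] := dh t ht.
- rewrite in_itv /= => /andP[c0 ch] E.
  have := fmax h; rewrite gtr0_norm // => /(_ he); rewrite -subr_le0 E subr0.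
  by rewrite leNgt mulr_gt0 // dpos // (lt_trans ch).
Qed.

End SecondDerivativeTest.

(** * Minkowski form, Lorentz matrices and frames *)

Section Minkowski.
Context {R : realType} {n : nat}.
Implicit Types (p q x y z v : 'rV[R]_n.+1).

Lemma lsign_sqr (i : 'I_n.+1) : lsign i * lsign i = 1 :> R.
Proof. by rewrite /lsign; case: ifP => _; rewrite ?mulrNN mulr1. Qed.

Definition eta : 'M[R]_n.+1 := diag_mx (\row_i lsign i).

Lemma eta_tr : eta^T = eta. Proof. exact: tr_diag_mx. Qed.

Lemma eta_sqr : eta *m eta = 1%:M.
Proof.
apply/matrixP => i j; rewrite /eta mul_diag_mx !mxE.
by case: eqVneq => [->|]; rewrite ?mulr1n ?mulr0n ?lsign_sqr ?mulr0.
Qed.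

Lemma mul_etaE x i : (x *m eta) 0 i = lsign i * x 0 i.
Proof. by rewrite /eta mul_mx_diag !mxE mulrC. Qed.

Lemma lformE x y : lform x y = (x *m eta *m y^T) 0 0.
Proof. by rewrite mxE /lform; apply: eq_bigr => i _; rewrite mul_etaE !mxE. Qed.

Lemma lformC x y : lform x y = lform y x.
Proof. by apply: eq_bigr => i _; rewrite mulrAC. Qed.

Lemma lformDl x y z : lform (x + y) z = lform x z + lform y z.
Proof. by rewrite /lform -big_split /=; apply: eq_bigr => i _; rewrite !mxE; ring. Qed.

Lemma lformZl a x z : lform (a *: x) z = a * lform x z.
Proof. by rewrite /lform mulr_sumr; apply: eq_bigr => i _; rewrite !mxE; ring. Qed.

Lemma lformNl x z : lform (- x) z = - lform x z.
Proof. by rewrite -scaleN1r lformZl mulN1r. Qed.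

Lemma lformBl x y z : lform (x - y) z = lform x z - lform y z.
Proof. by rewrite lformDl lformNl. Qed.

Lemma lformDr x y z : lform z (x + y) = lform z x + lform z y.
Proof. by rewrite !(lformC z) lformDl. Qed.

Lemma lformZr a x z : lform z (a *: x) = a * lform z x.
Proof. by rewrite !(lformC z) lformZl. Qed.

Lemma lformNr x z : lform z (- x) = - lform z x.
Proof. by rewrite !(lformC z) lformNl. Qed.

Lemma lformBr x y z : lform z (x - y) = lform z x - lform z y.
Proof. by rewrite !(lformC z) lformBl. Qed.

Definition lform_lin :=
  (lformDl, lformDr, lformBl, lformBr, lformZl, lformZr, lformNl, lformNr).

Lemma lform_time_space x y :
  lform x y = - (x 0 ord0 * y 0 ord0) + \sum_(i | i != ord0) x 0 i * y 0 i.
Proof.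
rewrite /lform (bigD1 ord0) //= {1}/lsign eqxx !mulN1r mulNr; congr (_ + _).
by apply: eq_bigr => i /negPf i0; rewrite /lsign i0 mul1r.
Qed.

(* AM-GM: [2 x_i y_i <= (y_0/x_0) x_i^2 + (x_0/y_0) y_i^2]. *)
Lemma lform_timelike_lt0 x y : lform x x < 0 -> 0 < x 0 ord0 ->
  lform y y < 0 -> 0 < y 0 ord0 -> lform x y < 0.
Proof.
move=> xx x0 yy y0; rewrite lform_time_space.
move: xx yy; rewrite !lform_time_space.
set a := x 0 ord0 in x0 *; set b := y 0 ord0 in y0 * => xx yy.
set sx := \sum_(i | _) x 0 i * x 0 i in xx; set sy := \sum_(i | _) y 0 i * y 0 i in yy.
set sxy := \sum_(i | _) x 0 i * y 0 i.
have H : 2 * a * b * sxy <= b ^+ 2 * sx + a ^+ 2 * sy.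
  rewrite /sx /sy /sxy !mulr_sumr -big_split /=; apply: ler_sum => i _.
  rewrite -subr_ge0 (_ : _ - _ = (b * x 0 i - a * y 0 i) ^+ 2); first exact: sqr_ge0.
  by ring.
have ab : 0 < a * b by rewrite mulr_gt0.
have H1 : b ^+ 2 * sx < b ^+ 2 * (a * a) by rewrite ltr_pM2l ?exprn_gt0 //; lra.
have H2 : a ^+ 2 * sy < a ^+ 2 * (b * b) by rewrite ltr_pM2l ?exprn_gt0 //; lra.
have : (2 * (a * b)) * sxy < (2 * (a * b)) * (a * b).
  rewrite !mulrA; apply: le_lt_trans H _; apply: lt_le_trans (ltrD H1 H2) _.
  by rewrite le_eqVlt; apply/orP; left; apply/eqP; ring.
by rewrite ltr_pM2l ?mulr_gt0 //; lra.
Qed.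

Definition lreflect v : 'M[R]_n.+1 := 1%:M - (2 / lform v v) *: (eta *m v^T *m v).

Lemma mul_lreflect v x : x *m lreflect v = x - (2 * lform x v / lform v v) *: v.
Proof.
rewrite /lreflect mulmxBr mulmx1 -scalemxAr !mulmxA.
rewrite [x *m eta *m v^T]mx11_scalar -lformE mul_scalar_mx scalerA.
by congr (_ - _ *: _); rewrite mulrAC.
Qed.

(** Vectors are rows and matrices act on the right, so this says that the rows of [S] form an
    orthonormal frame for [lform]. Time orientation is not included; [lorentz_hyp] recovers it from
    a fixed point. *)
Definition lorentz (S : 'M[R]_n.+1) := S *m eta *m S^T = eta.

Lemma lorentz_lform S x y : lorentz S -> lform (x *m S) (y *m S) = lform x y.
Proof.
by move=> HS; rewrite !lformE trmx_mul -[eta in RHS]HS !mulmxA.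
Qed.

Lemma lorentz_tr S : lorentz S -> S^T *m eta *m S = eta.
Proof.
move=> HS.
have H1 : S *m (eta *m S^T *m eta) = 1%:M by rewrite !mulmxA HS eta_sqr.
have := mulmx1C H1; rewrite -!mulmxA => H2.
by rewrite -[LHS]mul1mx -eta_sqr -!mulmxA H2 mulmx1.
Qed.

Lemma lorentzP S : (forall x y, lform (x *m S) (y *m S) = lform x y) -> lorentz S.
Proof.
move=> H; apply/matrixP => i j.
have := H (delta_mx 0 i) (delta_mx 0 j); rewrite -!rowE => E.
have -> : (S *m eta *m S^T) i j = lform (row i S) (row j S).
  by rewrite lformE -row_mul !mxE; apply: eq_bigr => k _; rewrite !mxE.
by rewrite E lformE -!rowE trmx_delta -colE !mxE.
Qed.

Lemma lreflect_lorentz v : lform v v != 0 -> lorentz (lreflect v).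
Proof.
move=> v0; apply: lorentzP => x y; rewrite !mul_lreflect !lform_lin (lformC v y).
by field.
Qed.

(** Equal norms give [2 <p, p - q> = <p - q, p - q>], so the reflection subtracts [p - q] exactly
    once. *)
Lemma lreflect_swap p q : lform p p = lform q q -> lform (p - q) (p - q) != 0 ->
  p *m lreflect (p - q) = q.
Proof.
move=> pq v0; rewrite mul_lreflect.
rewrite (_ : 2 * lform p (p - q) / lform (p - q) (p - q) = 1).
  by rewrite scale1r opprB addrC subrK.
move: v0; rewrite !lform_lin -pq (lformC q p) => v0.
set a := lform p p in v0 *; set b := lform p q in v0 *.
have -> : 2 * (a - b) = a - b + (- b - - a) by ring.
exact: divff.
Qed.

Lemma lreflect_fix v x : lform x v = 0 -> x *m lreflect v = x.
Proof. by move=> xv; rewrite mul_lreflect xv mulr0 mul0r scale0r subr0. Qed.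

(* The opposite of the reflection in [p + e_0] sends [e_0] to [p]. *)
Lemma hyp_frame p : hyp p -> exists2 S, lorentz S & row ord0 S = p.
Proof.
move=> [pp p0]; pose e0 : 'rV[R]_n.+1 := delta_mx 0 ord0.
have e0x x : lform e0 x = - x 0 ord0.
  rewrite lform_time_space !mxE !eqxx mul1r big1 ?addr0 // => i /negPf i0.
  by rewrite !mxE eqxx i0 mul0r.
have e0e0 : lform e0 e0 = -1 by rewrite e0x !mxE !eqxx.
have v0 : lform (p + e0) (p + e0) != 0.
  rewrite !lform_lin (lformC p e0) e0e0 e0x pp; apply: ltr0_neq0; lra.
exists (- lreflect (p + e0)).
  rewrite /lorentz linearN /= !mulNmx mulmxN opprK; exact: lreflect_lorentz.
rewrite rowE mulmxN -/e0.
have := @lreflect_swap e0 (-p); rewrite opprK addrC => -> //.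
- by rewrite opprK.
- by rewrite lformNl lformNr opprK pp.
Qed.

(* The inverse metric of the tangent space [p^\perp] of the hyperboloid at [p]:
   the sum of [f^T f] over an orthonormal basis of row vectors [f]. *)
Definition tmetric p : 'M[R]_n.+1 := eta + p^T *m p.

Lemma tmetric_tr p : (tmetric p)^T = tmetric p.
Proof. by rewrite /tmetric linearD /= eta_tr trmx_mul trmxK. Qed.

Lemma tmetric_mul p S : lorentz S -> S^T *m tmetric p *m S = tmetric (p *m S).
Proof. by move=> HS; rewrite /tmetric mulmxDr mulmxDl lorentz_tr // trmx_mul !mulmxA. Qed.

Lemma lorentz_eta_sum S : lorentz S ->
  eta = \sum_k lsign k *: ((row k S)^T *m row k S).
Proof.
move=> /lorentz_tr <-; apply/matrixP => i j.
rewrite summxE mxE; apply: eq_bigr => k _.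
by rewrite mul_mx_diag !mxE big_ord1 !mxE; ring.
Qed.

(** The term [p^T p] cancels the negative time term of [eta]; the remaining sum makes [tmetric]
    positive semidefinite. *)
Lemma tmetric_sum S : lorentz S ->
  tmetric (row ord0 S) = \sum_(k | k != ord0) (row k S)^T *m row k S.
Proof.
move=> HS; rewrite /tmetric (lorentz_eta_sum HS) (bigD1 ord0) //=.
rewrite {1}/lsign eqxx scaleN1r addrAC addNr add0r.
by apply: eq_bigr => k /negPf k0; rewrite /lsign k0 scale1r.
Qed.

Lemma lorentz_decomp S x : lorentz S ->
  x = \sum_k (lsign k * lform x (row k S)) *: row k S.
Proof.
move=> HS; rewrite -{1}[x]mulmx1 -eta_sqr mulmxA {2}(lorentz_eta_sum HS).
rewrite mulmx_sumr; apply: eq_bigr => k _.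
by rewrite -scalemxAr mulmxA [x *m eta *m _]mx11_scalar -lformE mul_scalar_mx scalerA.
Qed.

Lemma lorentz_norm S x : lorentz S ->
  lform x x = - lform x (row ord0 S) ^+ 2 + \sum_(k | k != ord0) lform x (row k S) ^+ 2.
Proof.
move=> HS; rewrite {2}(lorentz_decomp x HS).
have -> : lform x (\sum_k (lsign k * lform x (row k S)) *: row k S) =
    \sum_k lsign k * lform x (row k S) ^+ 2.
  rewrite (big_morph (lform x) (fun a b => lformDr a b x) (_ : lform x 0 = 0)).
    by apply: eq_bigr => k _; rewrite lformZr expr2 mulrA.
  by rewrite -(scale0r x) lformZr mul0r.
rewrite (bigD1 ord0) //= {1}/lsign eqxx mulN1r; congr (_ + _).
by apply: eq_bigr => k /negPf k0; rewrite /lsign k0 mul1r.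
Qed.

Lemma lform_hyp_lt0 p q : hyp p -> hyp q -> lform p q < 0.
Proof. by move=> [pp p0] [qq q0]; apply: lform_timelike_lt0; rewrite ?pp ?qq // ltrN10. Qed.

(** Reverse Cauchy-Schwarz inequality: in a frame with time vector [p], [<p,q>^2] is 1 plus a sum of
    squares, and [<p,q> < 0] selects the root. It puts the argument of [arcosh] in [hdist] into the
    right range. *)
Lemma lform_hyp_le p q : hyp p -> hyp q -> 1 <= - lform p q.
Proof.
move=> hp hq; have [S HS Sp] := hyp_frame hp; have := lorentz_norm q HS.
rewrite Sp (lformC q p) hq.1 => E.
have pq0 := lform_hyp_lt0 hp hq.
have s0 : 0 <= \sum_(k | k != ord0) lform q (row k S) ^+ 2 :> R.
  by apply: sumr_ge0 => k _; exact: sqr_ge0.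
by nra.
Qed.

Lemma lform_hyp_eq p q : hyp p -> hyp q -> lform p q = -1 -> p = q.
Proof.
move=> hp hq pq; have [S HS Sp] := hyp_frame hp; have := lorentz_norm q HS.
rewrite Sp (lformC q p) hq.1 pq sqrrN expr1n => E.
have s0 : \sum_(k | k != ord0) lform q (row k S) ^+ 2 == 0 :> R by apply/eqP; lra.
move: s0; rewrite psumr_eq0 => [/allP s0|k _]; last exact: sqr_ge0.
rewrite (lorentz_decomp q HS) (bigD1 ord0) //= big1 => [|k k0].
  by rewrite Sp (lformC q p) pq /lsign eqxx mulrNN mulr1 scale1r addr0.
have := s0 k (mem_index_enum _); rewrite k0 /= sqrf_eq0 => /eqP ->.
by rewrite mulr0 scale0r.
Qed.

(** The value is [2 (- <p,q> - 1)]. Its positivity makes the reflection exchanging [p] and [q]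
    available. *)
Lemma lform_sub_gt0 p q : hyp p -> hyp q -> p != q -> 0 < lform (p - q) (p - q).
Proof.
move=> hp hq pq; rewrite !lform_lin hp.1 hq.1 (lformC q p).
have := lform_hyp_le hp hq; rewrite le_eqVlt => /orP[/eqP E|]; last by lra.
by move: pq; rewrite (lform_hyp_eq hp hq) ?eqxx //; lra.
Qed.

(** If [z] were on the past sheet, [- z] would be in [hyp] and would have a negative product with
    [c]. *)
Lemma hyp_of_lform c z : hyp c -> lform z z = -1 -> lform z c < 0 -> hyp z.
Proof.
move=> hc zz zc; split=> //; rewrite ltNge; apply/negP => z0.
have z0' : z 0 ord0 < 0.
  rewrite lt_neqAle z0 andbT; apply/eqP => E; move: zz; rewrite lform_time_space E.
  rewrite mul0r oppr0 add0r => H.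
  have : 0 <= \sum_(i | i != ord0) z 0 i * z 0 i.
    by apply: sumr_ge0 => i _; rewrite -expr2; exact: sqr_ge0.
  by rewrite H; lra.
have hN : hyp (- z) by split; [rewrite lformNl lformNr opprK|rewrite mxE oppr_gt0].
by have := lform_hyp_lt0 hN hc; rewrite lformNl; lra.
Qed.

Lemma lorentz_hyp c p S : lorentz S -> hyp c -> hyp p -> c *m S = c -> hyp (p *m S).
Proof.
move=> HS hc hp cS; apply: (hyp_of_lform hc); first by rewrite lorentz_lform // hp.1.
by rewrite -{1}cS lorentz_lform //; exact: lform_hyp_lt0.
Qed.

End Minkowski.

(** * Hyperbolic cosine and sine; [arcosh] as an inverse of the cosine *)

Section HyperbolicFunctions.
Context {R : realType}.
Implicit Types (s t a : R).

Definition ch s : R := (expR s + expR (- s)) / 2.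
Definition sh s : R := (expR s - expR (- s)) / 2.

Lemma ch_sqr s : ch s ^+ 2 = 1 + sh s ^+ 2.
Proof.
have E : expR s * expR (- s) = 1 by rewrite expRN mulfV // gt_eqF // expR_gt0.
rewrite /ch /sh; set x := expR s in E *; set y := expR (- s) in E *.
have -> : ((x + y) / 2) ^+ 2 = x * y + ((x - y) / 2) ^+ 2 by field.
by rewrite E.
Qed.

Lemma ch_add_sh s : ch s + sh s = expR s. Proof. by rewrite /ch /sh; field. Qed.

Lemma sh_gt0 s : 0 < s -> 0 < sh s.
Proof. by move=> s0; rewrite /sh divr_gt0 // subr_gt0 ltr_expR; lra. Qed.

Lemma sh_ge0 s : 0 <= s -> 0 <= sh s.
Proof. by move=> s0; rewrite /sh divr_ge0 // subr_ge0 ler_expR; lra. Qed.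

Lemma ch_ge1 s : 1 <= ch s.
Proof.
have H : 1 <= ch s ^+ 2 by rewrite ch_sqr lerDl sqr_ge0.
have ch0 : 0 <= ch s by rewrite /ch divr_ge0 // addr_ge0 // expR_ge0.
by rewrite -(@expr_ge1 R 2).
Qed.

Lemma ch_gt0 s : 0 < ch s. Proof. exact: lt_le_trans ltr01 (ch_ge1 s). Qed.

Lemma ch0 : ch 0 = 1. Proof. by rewrite /ch oppr0 expR0; field. Qed.
Lemma sh0 : sh 0 = 0. Proof. by rewrite /sh oppr0 expR0 subrr mul0r. Qed.
Lemma chN s : ch (- s) = ch s. Proof. by rewrite /ch opprK addrC. Qed.
Lemma shN s : sh (- s) = - sh s. Proof. by rewrite /sh opprK -mulNr opprB. Qed.

Lemma is_derive_ch s : is_derive s 1 ch (sh s).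
Proof.
have -> : ch = (2^-1 *: (expR + (expR \o -%R))) :> (R -> R).
  by apply/funext => t; rewrite -[RHS]/(2^-1 * (expR t + expR (- t))) mulrC.
by apply: is_derive_eq; rewrite /sh mulrN1 mulrC.
Qed.

Lemma is_derive_sh s : is_derive s 1 sh (ch s).
Proof.
have -> : sh = (2^-1 *: (expR - (expR \o -%R))) :> (R -> R).
  by apply/funext => t; rewrite -[RHS]/(2^-1 * (expR t - expR (- t))) mulrC.
by apply: is_derive_eq; rewrite /ch mulrN1 opprK mulrC.
Qed.

Lemma cothE s : coth s = ch s / sh s.
Proof.
by rewrite /coth /ch /sh -mulf_div divff ?mulr1 // invr_eq0.
Qed.

Lemma arcosh_ch s : 0 <= s -> arcosh (ch s) = s.
Proof.
move=> s0; have E : ch s ^+ 2 - 1 = sh s ^+ 2 by rewrite ch_sqr addrAC subrr add0r.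
by rewrite /arcosh E sqrtr_sqr ger0_norm ?sh_ge0 // ch_add_sh expRK.
Qed.

Lemma arcosh_arg a : 1 <= a -> 1 <= a + Num.sqrt (a ^+ 2 - 1).
Proof. by move=> a1; rewrite (le_trans a1) // lerDl sqrtr_ge0. Qed.

Lemma ch_arcosh a : 1 <= a -> ch (arcosh a) = a.
Proof.
move=> a1; have z1 := arcosh_arg a1.
rewrite /ch expRN /arcosh lnK ?posrE ?(lt_le_trans ltr01) //.
have sq : Num.sqrt (a ^+ 2 - 1) ^+ 2 = a ^+ 2 - 1.
  by rewrite sqr_sqrtr // subr_ge0 expr_ge1 // (le_trans ler01).
set z := Num.sqrt _ in z1 sq *.
have z0 : a + z != 0 by rewrite gt_eqF // (lt_le_trans ltr01).
have -> : (a + z)^-1 = a - z.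
  by by apply: (mulfI z0); rewrite divff // mulrC -subr_sqr sq; ring.
by field.
Qed.

Lemma arcosh_ge0 a : 1 <= a -> 0 <= arcosh a.
Proof. by move=> a1; rewrite /arcosh ln_ge0 // arcosh_arg. Qed.

Lemma ltr_ch s t : 0 <= s -> 0 <= t -> (ch s < ch t) = (s < t).
Proof.
have mono x y : 0 <= x -> x < y -> ch x < ch y.
  move=> x0 xy; rewrite /ch ltr_pM2r ?invr_gt0 //.
  have xy0 : 0 < expR x * expR y - 1.
    by rewrite -expRD subr_gt0 -expR0 ltr_expR; lra.
  have ex : 0 < expR x by exact: expR_gt0.
  have ey : 0 < expR y by exact: expR_gt0.
  have exy : 0 < expR y - expR x by rewrite subr_gt0 ltr_expR.
  rewrite !expRN -subr_gt0.
  have -> : expR y + (expR y)^-1 - (expR x + (expR x)^-1) =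
     (expR y - expR x) * (expR x * expR y - 1) / (expR x * expR y).
    by field; rewrite !gt_eqF.
  by rewrite divr_gt0 // mulr_gt0.
move=> s0 t0; case: (ltgtP s t) => [st|ts|->]; first exact: mono.
  by apply/negbTE; rewrite -leNgt ltW // mono.
exact: ltxx.
Qed.

Lemma ler_ch s t : 0 <= s -> 0 <= t -> (ch s <= ch t) = (s <= t).
Proof. by move=> s0 t0; rewrite !leNgt ltr_ch. Qed.

End HyperbolicFunctions.

(** * Distance, radial projection and balls on the hyperboloid *)

Section Hyperboloid.
Context {R : realType} {n : nat}.
Implicit Types (c p q x y z v : 'rV[R]_n.+1) (r s : R).

Lemma hdist_ge0 c p : hyp c -> hyp p -> 0 <= hdist c p.
Proof. by move=> hc hp; apply/arcosh_ge0/lform_hyp_le. Qed.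

Lemma ch_hdist c p : hyp c -> hyp p -> ch (hdist c p) = - lform c p.
Proof. by move=> hc hp; apply/ch_arcosh/lform_hyp_le. Qed.

Lemma hdist_lt c p r : hyp c -> hyp p -> 0 <= r ->
  (hdist c p < r) = (- lform c p < ch r).
Proof. by move=> hc hp r0; rewrite -ch_hdist // ltr_ch // hdist_ge0. Qed.

Lemma hdist_le c p r : hyp c -> hyp p -> 0 <= r ->
  (hdist c p <= r) = (- lform c p <= ch r).
Proof. by move=> hc hp r0; rewrite -ch_hdist // ler_ch // hdist_ge0. Qed.

Lemma hdist_eq0 c p : hyp c -> hyp p -> hdist c p = 0 -> c = p.
Proof.
move=> hc hp cp; apply: lform_hyp_eq => //; have := ch_hdist hc hp.
by rewrite cp ch0; lra.
Qed.

Lemma hdist_lorentz S c p : lorentz S -> hdist (c *m S) (p *m S) = hdist c p.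
Proof. by move=> HS; rewrite /hdist lorentz_lform. Qed.

(** The puncture becomes the strict inequality [1 < - <c,p>], so that openness follows from the
    continuity of [lform c]. *)
Lemma hball_starP c r p : hyp c -> 0 <= r ->
  hball_star c r p <-> [/\ hyp p, 1 < - lform c p & - lform c p < ch r].
Proof.
move=> hc r0; split=> [[[hp cpr] /eqP pc]|[hp cp1 cpr]].
  rewrite hdist_lt // in cpr; split=> //.
  rewrite lt_neqAle lform_hyp_le // andbT eq_sym; apply: contra pc => /eqP E.
  by rewrite (@lform_hyp_eq _ _ c p) // -E opprK.
split; first by split=> //; rewrite hdist_lt.
by move=> /= E; move: cp1; rewrite E hc.1 opprK ltxx.
Qed.

Lemma hproj_id p : hyp p -> hproj p = p.
Proof. by move=> [pp _]; rewrite /hproj pp opprK sqrtr1 invr1 scale1r. Qed.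

Lemma lform_hproj x : lform x x < 0 -> lform (hproj x) (hproj x) = -1.
Proof.
move=> xx; rewrite /hproj lformZl lformZr mulrA -invfM -expr2 sqr_sqrtr; last by lra.
by rewrite invrN mulNr mulVf // lt_eqF.
Qed.

Lemma hyp_hproj x : lform x x < 0 -> 0 < x 0 ord0 -> hyp (hproj x).
Proof.
move=> xx x0; split; first exact: lform_hproj.
by rewrite mxE mulr_gt0 // invr_gt0 sqrtr_gt0; lra.
Qed.

Lemma hyp_hprojP x : hyp (hproj x) -> lform x x < 0 /\ 0 < x 0 ord0.
Proof.
move=> [H1 H2]; have xx : lform x x < 0.
  rewrite ltNge; apply/negP => xx; move: H1; rewrite /hproj ler0_sqrtr; last by lra.
  rewrite invr0 scale0r -(scale0r x) lformZl mul0r => /eqP.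
  by rewrite eq_sym oppr_eq0 oner_eq0.
split=> //; move: H2; rewrite mxE pmulr_rgt0 // invr_gt0 sqrtr_gt0; lra.
Qed.

Lemma hprojZ a x : 0 < a -> hproj (a *: x) = hproj x.
Proof.
move=> a0; rewrite /hproj lformZl lformZr mulrA -mulrN sqrtrM ?mulr_ge0 ?ltW //.
rewrite -expr2 sqrtr_sqr gtr0_norm // invfM scalerA mulrAC mulVf ?mul1r //.
by rewrite gt_eqF.
Qed.

Lemma hproj_mul S x : lorentz S -> hproj (x *m S) = hproj x *m S.
Proof. by move=> HS; rewrite /hproj lorentz_lform // -scalemxAl. Qed.

Lemma lform_continuous c : continuous (lform c).
Proof.
rewrite (_ : lform c = fun y : 'rV[R]_n.+1 => \sum_i lsign i * c 0 i * y 0 i) //.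
apply: continuous_big => [|i _ v]; first exact: add_continuous.
apply: (@continuousM _ _ (fun=> lsign i * c 0 i) (fun y : 'rV[R]_n.+1 => y 0 i)).
  exact: cst_continuous.
exact: coord_continuous.
Qed.

Lemma lform_diag_continuous : continuous (fun x : 'rV[R]_n.+1 => lform x x).
Proof.
apply: continuous_big => [|i _ v]; first exact: add_continuous.
apply: (@continuousM _ _ (fun y : 'rV[R]_n.+1 => lsign i * y 0 i) (fun y : 'rV[R]_n.+1 => y 0 i)).
  apply: (@continuousM _ _ (fun=> lsign i) (fun y : 'rV[R]_n.+1 => y 0 i)).
    exact: cst_continuous.
  exact: coord_continuous.
exact: coord_continuous.
Qed.

Lemma lform_hproj_continuous c x : lform x x < 0 ->
  {for x, continuous (fun y => lform c (hproj y))}.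
Proof.
move=> xx.
rewrite (_ : (fun y => lform c (hproj y)) =
   (fun y => (Num.sqrt (- lform y y))^-1 * lform c y)); last first.
  by apply/funext => y; rewrite lformZr.
apply: continuousM; last exact: lform_continuous.
apply: continuousV; first by rewrite gt_eqF // sqrtr_gt0; lra.
apply: (@continuous_comp _ _ _ (fun y => - lform y y) Num.sqrt).
  by apply: continuousN; exact: lform_diag_continuous.
exact: sqrt_continuous.
Qed.

Lemma near_lt (f : 'rV[R]_n.+1 -> R) x a : {for x, continuous f} -> f x < a ->
  nbhs x [set y | f y < a].
Proof. by move=> cf fxa; exact: (cf _ (lt_nbhsl fxa)). Qed.

Lemma near_gt (f : 'rV[R]_n.+1 -> R) x a : {for x, continuous f} -> a < f x ->
  nbhs x [set y | a < f y].
Proof. by move=> cf fxa; exact: (cf _ (lt_nbhsr fxa)). Qed.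

(** Subsets of the hyperboloid have empty interior in the flat space; the open set on which
    derivatives are taken is the cone over them. *)
Lemma cone_hball_star c r x : hyp c -> 0 <= r ->
  (hproj @^-1` hball_star c r) x -> nbhs x (hproj @^-1` hball_star c r).
Proof.
move=> hc r0 /hball_starP -/(_ hc r0)[/hyp_hprojP[xx x0] x1 xr].
have cx := lform_hproj_continuous (c := c) xx.
have N1 := near_lt (@lform_diag_continuous x) xx.
have N2 := near_gt (@coord_continuous R _ _ 0 ord0 x) x0.
have N3 : nbhs x [set y | lform c (hproj y) < -1] by apply: near_lt => //; lra.
have N4 : nbhs x [set y | - ch r < lform c (hproj y)] by apply: near_gt => //; lra.
apply: filterS (filterI (filterI N1 N2) (filterI N3 N4)) => y /= [[y1 y2] [y3 y4]].
by apply/hball_starP => //; split; [exact: hyp_hproj|lra|lra].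
Qed.

Lemma cone_hball c r x : hyp c -> 0 <= r ->
  (hproj @^-1` hball c r) x -> nbhs x (hproj @^-1` hball c r).
Proof.
move=> hc r0 [hx]; rewrite hdist_lt // => xr; have [xx x0] := hyp_hprojP hx.
have cx := lform_hproj_continuous (c := c) xx.
have N1 := near_lt (@lform_diag_continuous x) xx.
have N2 := near_gt (@coord_continuous R _ _ 0 ord0 x) x0.
have N4 : nbhs x [set y | - ch r < lform c (hproj y)] by apply: near_gt => //; lra.
apply: filterS (filterI (filterI N1 N2) N4) => y /= [[y1 y2] y4].
have hy := hyp_hproj y1 y2.
by split=> //; rewrite hdist_lt //; lra.
Qed.

Definition cball c r : set 'rV[R]_n.+1 := [set p | hyp p /\ hdist c p <= r].

Lemma hyp_ge1 p : hyp p -> 1 <= p 0 ord0.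
Proof.
move=> [pp p0]; move: pp; rewrite lform_time_space => E.
have : 0 <= \sum_(i | i != ord0) p 0 i * p 0 i.
  by apply: sumr_ge0 => i _; rewrite -expr2 sqr_ge0.
by move: E; nra.
Qed.

Lemma cball_closed c r : hyp c -> 0 <= r -> closed (cball c r).
Proof.
move=> hc r0.
(* The strict condition on the time coordinate is replaced by [1 <= p 0 ord0], which is closed and
   still separates the two sheets. *)
have -> : cball c r = [set p : 'rV[R]_n.+1 | lform p p = -1] `&`
    [set p | 1 <= p 0 ord0] `&` [set p | - ch r <= lform c p].
  apply/seteqP; split=> p /=.
    by move=> [hp]; rewrite hdist_le // => ?; split; [split; [exact: hp.1|exact: hyp_ge1]|lra].
  move=> [[pp p0] cp]; have hp : hyp p by split=> //; lra.
  by split=> //; rewrite hdist_le //; lra.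
apply: closedI; first apply: closedI.
- apply: (@preimage_closed _ _ (fun p : 'rV[R]_n.+1 => lform p p) [set -1]).
    by move=> p _; exact: lform_diag_continuous.
  exact: closed_eq.
- apply: (@preimage_closed _ _ (fun p : 'rV[R]_n.+1 => p 0 ord0) [set x | 1 <= x]).
    by move=> p _; exact: coord_continuous.
  exact: closed_ge.
- apply: (@preimage_closed _ _ (lform c) [set x | - ch r <= x]).
    by move=> p _; exact: lform_continuous.
  exact: closed_ge.
Qed.

(** In a frame with time vector [c], the squares of the space coefficients of [p] add up to
    [<c,p>^2 - 1], so every coefficient is at most [ch r] in absolute value. *)
Lemma cball_bounded c r : hyp c -> 0 <= r ->
  exists b : R, forall p, cball c r p -> forall j, `|p 0 j| <= b.
Proof.
move=> hc r0; have [S HS Sc] := hyp_frame hc.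
exists (\sum_j \sum_k ch r * `|S k j|) => p [hp]; rewrite hdist_le // => cpr j.
have key k : `|lform p (row k S)| <= ch r.
  have ch0 := ch_gt0 r.
  have := lorentz_norm p HS; rewrite hp.1 Sc (lformC p c) => E.
  have [->|k0] := eqVneq k ord0.
    rewrite Sc lformC -normrN ger0_norm //.
    by have := lform_hyp_le hc hp; lra.
  have H : lform p (row k S) ^+ 2 <= ch r ^+ 2.
    move: E; rewrite (bigD1 k) //= => E.
    have s0 : 0 <= \sum_(i | (i != ord0) && (i != k)) lform p (row i S) ^+ 2.
      by apply: sumr_ge0 => i _; exact: sqr_ge0.
    have H2 : lform c p ^+ 2 <= ch r ^+ 2.
      rewrite -sqrrN lerXn2r ?nnegrE //; last by rewrite ltW.
      by have := lform_hyp_le hc hp; lra.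
    by lra.
  by rewrite -(@ler_pXn2r _ 2) ?nnegrE ?(ltW ch0) // real_normK ?num_real.
apply: (@le_trans _ _ (\sum_k ch r * `|S k j|)); last first.
  rewrite [leRHS](bigD1 j) //= lerDl; apply: sumr_ge0 => i _; apply: sumr_ge0 => k _.
  by rewrite mulr_ge0 // ltW // ch_gt0.
rewrite {1}(lorentz_decomp p HS) summxE; apply: le_trans (ler_norm_sum _ _ _) _.
apply: ler_sum => k _; rewrite !mxE !normrM -mulrA.
have -> : `|lsign k : R| = 1 by rewrite /lsign; case: ifP => _; rewrite ?normrN normr1.
by rewrite mul1r ler_wpM2r.
Qed.

(** The closure is taken in the flat space; it stays on the hyperboloid because the closed
    hyperbolic ball is closed there. *)
Lemma closure_hball_compact c r (A : set 'rV[R]_n.+1) : hyp c -> 0 <= r ->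
  A `<=` hball c r -> compact (closure A) /\ closure A `<=` cball c r.
Proof.
move=> hc r0 Ab; have AB : closure A `<=` cball c r.
  rewrite ((closure_id _).1 (cball_closed hc r0)); apply: closureS.
  by move=> p /Ab[hp /ltW].
split=> //; apply: bounded_closed_compact; last exact: closed_closure.
have [b Hb] := cball_bounded hc r0.
exists b; split; first exact: num_real.
move=> x bx p /AB/Hb H /=; rewrite [leLHS]/Num.Def.normr /= mx_normrE; apply: bigmax_le => [|[i j] _ /=].
  by rewrite (le_trans _ (ltW bx)) // (le_trans (normr_ge0 _) (H ord0)).
by rewrite ord1 (le_trans (H j)) // ltW.
Qed.

End Hyperboloid.

(** * Calculus along curves and the non-divergence form of the equation *)

Section FlatCalculus.
Context {R : realType}.

Lemma is_derive_add (f g : R -> R) (t a b : R) : is_derive t 1 f a ->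
  is_derive t 1 g b -> is_derive t 1 (fun s => f s + g s) (a + b).
Proof. exact: is_deriveD. Qed.

Lemma is_derive_sub (f g : R -> R) (t a b : R) : is_derive t 1 f a ->
  is_derive t 1 g b -> is_derive t 1 (fun s => f s - g s) (a - b).
Proof. exact: is_deriveB. Qed.

Lemma is_derive_mul (f g : R -> R) (t a b : R) : is_derive t 1 f a ->
  is_derive t 1 g b -> is_derive t 1 (fun s => f s * g s) (f t * b + g t * a).
Proof. exact: is_deriveM. Qed.

Lemma is_derive_scale (k : R) (f : R -> R) (t a : R) : is_derive t 1 f a ->
  is_derive t 1 (fun s => k * f s) (k * a).
Proof. exact: is_deriveZ. Qed.

Lemma is_derive_sqr (f : R -> R) (t a : R) : is_derive t 1 f a ->
  is_derive t 1 (fun s => f s ^+ 2) (2 * f t * a).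
Proof.
by move=> df; apply: (is_derive_eq (is_derive_mul df df)); ring.
Qed.

Lemma is_derive_cst1 (k t : R) : is_derive t 1 (fun=> k) 0.
Proof. exact: is_derive_cst. Qed.

Lemma is_derive_id1 (t : R) : is_derive t 1 (fun s : R => s) 1.
Proof. exact: is_derive_id. Qed.

Lemma is_derive_comp (f g : R -> R) (t a b : R) : is_derive (g t) 1 f a ->
  is_derive t 1 g b -> is_derive t 1 (fun s => f (g s)) (a * b).
Proof. exact: is_derive1_comp. Qed.

Lemma is_derive_inv (f : R -> R) (x d : R) : f x != 0 -> is_derive x 1 f d ->
  is_derive x 1 (fun y => (f y)^-1) (- d / f x ^+ 2).
Proof.
move=> fx [df <-]; apply: DeriveDef; first exact: derivableV.
by rewrite deriveV // -[LHS]/(- (f x) ^- 2 * 'D_1 f x) mulrC mulrN mulNr.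
Qed.

Lemma is_derive_invsqrt (f : R -> R) (x d : R) : 0 < f x -> is_derive x 1 f d ->
  is_derive x 1 (fun y => (Num.sqrt (f y))^-1) (- d / (2 * Num.sqrt (f x) ^+ 3)).
Proof.
move=> fx df; have s0 : Num.sqrt (f x) != 0 by rewrite gt_eqF // sqrtr_gt0.
have ds := is_derive1_comp (is_derive1_sqrt fx) df.
apply: (is_derive_eq (@is_derive_inv (fun y => Num.sqrt (f y)) x _ s0 ds)).
by field.
Qed.

Lemma is_derive_const_near (f : R -> R) (t a k e : R) : 0 < e ->
  (forall s, `|s - t| < e -> f s = k) -> is_derive t 1 f a -> a = 0.
Proof.
move=> e0 fk [_ <-].
rewrite (@near_eq_derive R R R f (cst k) t 1) ?oner_eq0 ?derive_cst //.
by apply/nbhs_ballP; exists e => //= s; rewrite -ball_normE /= distrC => /fk.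
Qed.

Lemma derive_of_line n (f : 'rV[R]_n -> R) (x v : 'rV[R]_n) (l : R) :
  is_derive (0 : R) 1 (fun t => f (x + t *: v)) l -> 'D_v f x = l.
Proof.
move=> [_ <-]; rewrite /derive.
suff -> : (fun h : R => h^-1 *: (f (h *: v + x) - f x)) =
  (fun h : R => h^-1 *: (f (x + (h *: (1 : R) + 0) *: v) - f (x + 0 *: v))) by [].
apply/funext => h; by rewrite scale0r !addr0 -[h *: (1 : R)]/(h * 1) mulr1 (addrC x).
Qed.

Lemma is_derive_bigsum n (h : 'I_n -> R -> R) (t : R) (dh : 'I_n -> R) :
  (forall i, is_derive t 1 (h i) (dh i)) ->
  is_derive t 1 (fun s => \sum_i h i s) (\sum_i dh i).
Proof.
move=> H; have -> : (fun s => \sum_i h i s) = \sum_i h i.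
  by apply/funext => s; rewrite fct_sumE.
exact: is_derive_sum.
Qed.

Context {n : nat}.
Implicit Types (U : set 'rV[R]_n.+1) (F : 'rV[R]_n.+1 -> R) (x v : 'rV[R]_n.+1).

Definition hess F x : 'M[R]_n.+1 := \matrix_(j, i) pderiv j (pderiv i F) x.

Lemma C1_differentiable U F x : C1_flat U F -> nbhs x U ->
  differentiable F x /\ forall v, 'd F x v = (v *m partial_grad F x) 0 0.
Proof.
move=> CF xU; apply: (differentiable_of_partials xU) => [y i Uy|i].
  by have [] := CF y Uy i.
by have [] := CF x (nbhs_singleton xU) i.
Qed.

Lemma C1_chain U F (g : R -> 'rV[R]_n.+1) (t : R) (dg : 'rV[R]_n.+1) :
  C1_flat U F -> nbhs (g t) U ->
  (forall i, is_derive t 1 (fun s => g s 0 i) (dg 0 i)) ->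
  is_derive t 1 (fun s => F (g s)) ((dg *m partial_grad F (g t)) 0 0).
Proof.
move=> CF gU dgi; have [dF dE] := C1_differentiable CF gU.
by rewrite -dE; exact: is_derive_chain.
Qed.

(** The first term pairs the acceleration with the gradient. It is zero on straight lines and on
    geodesics, whose acceleration is radial; on circles about [c] it produces the [coth] term. *)
Lemma C2_chain U F (g g1 : R -> 'rV[R]_n.+1) (t : R) (g2 : 'rV[R]_n.+1) :
  C2_flat U F -> nbhs (g t) U ->
  (forall i, is_derive t 1 (fun s => g s 0 i) (g1 t 0 i)) ->
  (forall i, is_derive t 1 (fun s => g1 s 0 i) (g2 0 i)) ->
  is_derive t 1 (fun s => (g1 s *m partial_grad F (g s)) 0 0)
    ((g2 *m partial_grad F (g t)) 0 0 + (g1 t *m hess F (g t) *m (g1 t)^T) 0 0).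
Proof.
move=> [CF CCF] gU dg dg1.
have -> : (fun s => (g1 s *m partial_grad F (g s)) 0 0) =
    (fun s => \sum_i g1 s 0 i * pderiv i F (g s)).
  by apply/funext => s; rewrite mxE; apply: eq_bigr => i _; rewrite mxE.
have H i := C1_chain (CCF i) gU dg.
have HS := @is_derive_bigsum _ (fun i s => g1 s 0 i * pderiv i F (g s)) t _
  (fun i => is_derive_mul (dg1 i) (H i)).
apply: (is_derive_eq HS).
rewrite /= [RHS]addrC !mxE -big_split /=; apply: eq_bigr => i _.
rewrite !mxE; congr (_ + _); last by rewrite mulrC.
by rewrite mulrC; congr (_ * _); apply: eq_bigr => j _; rewrite !mxE.
Qed.

Lemma is_derive_affine_coord x v (t : R) i :
  is_derive t 1 (fun s : R => (x + s *: v) 0 i) (v 0 i).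
Proof.
have -> : (fun s : R => (x + s *: v) 0 i) = (fun s => x 0 i + v 0 i * s).
  by apply/funext => s; rewrite !mxE mulrC.
apply: (is_derive_eq (is_derive_add (is_derive_cst1 (x 0 i) t)
  (is_derive_scale (v 0 i) (is_derive_id1 t)))).
by rewrite add0r mulr1.
Qed.

Lemma is_derive_cst_coord v (t : R) i :
  is_derive t 1 (fun s : R => v 0 i) ((0 : 'rV[R]_n.+1) 0 i).
Proof. by rewrite mxE; exact: is_derive_cst. Qed.

Lemma C1_line U F x v (t : R) : C1_flat U F -> nbhs (x + t *: v) U ->
  is_derive t 1 (fun s => F (x + s *: v)) ((v *m partial_grad F (x + t *: v)) 0 0).
Proof.
by move=> CF xU; apply: (C1_chain CF xU) => i; exact: is_derive_affine_coord.
Qed.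

Lemma C2_line U F x v (t : R) : C2_flat U F -> nbhs (x + t *: v) U ->
  is_derive t 1 (fun s => (v *m partial_grad F (x + s *: v)) 0 0)
    ((v *m hess F (x + t *: v) *m v^T) 0 0).
Proof.
move=> CF xU; apply: (is_derive_eq (C2_chain CF xU (g1 := fun=> v) (is_derive_affine_coord x v t)
  (is_derive_cst_coord v t))).
by rewrite mul0mx mxE add0r.
Qed.

Lemma hext_ray (u : 'rV[R]_n.+1 -> R) p (s : R) : -1 < s ->
  hext u (p + s *: p) = hext u p.
Proof.
by move=> s1; rewrite -{1}(scale1r p) -scalerDl /hext /= hprojZ //; lra.
Qed.

(** Euler's identities in degree 0: the extension is constant on the ray through [p], so both
    derivatives along it vanish. *)
Lemma hext_radial U (u : 'rV[R]_n.+1 -> R) p :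
  (forall x, U x -> nbhs x U) -> C2_flat U (hext u) -> U p ->
  (p *m partial_grad (hext u) p) 0 0 = 0 /\ (p *m hess (hext u) p *m p^T) 0 0 = 0.
Proof.
move=> Uo CU Up.
have [d /= d0 dU] := (nbhs_ballP p U).1 (Uo _ Up).
(* The bound 1/2 keeps [1 + s] positive, hence [p + s p] on the ray; the other bound keeps this
   point in [U]. *)
pose e := Num.min (1 / 2) (d / (`|p| + 1)).
have p1 : 0 < `|p| + 1 by rewrite ltr_wpDl.
have e0 : 0 < e by rewrite lt_min !divr_gt0.
have inU s : `|s| < e -> nbhs (p + s *: p) U /\ -1 < s.
  rewrite lt_min => /andP[s1 sd]; split; last by move: s1; rewrite ltr_norml; lra.
  apply/Uo/dU; rewrite -ball_normE /ball_ /= opprD addrA subrr sub0r normrN normrZ.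
  move: sd; rewrite ltr_pdivlMr // => /le_lt_trans; apply.
  by rewrite ler_wpM2l // lerDl.
have D1 s : `|s| < e -> (p *m partial_grad (hext u) (p + s *: p)) 0 0 = 0.
  move=> se; have [sU s1] := inU s se.
  have e1 : 0 < e - `|s| by rewrite subr_gt0.
  apply: (@is_derive_const_near (fun t => hext u (p + t *: p)) s _ (hext u p) _ e1).
    move=> t ts; rewrite hext_ray //.
    have te : `|t| < e.
      rewrite -(subrK s t); apply: le_lt_trans (ler_normD _ _) _; lra.
    exact: (inU t te).2.
  exact: (C1_line CU.1 sU).
have E0 : p + 0 *: p = p by rewrite scale0r addr0.
have z0 : `|0 : R| < e by rewrite normr0.
split; first by have := D1 0 z0; rewrite E0.
have H := C2_line CU (inU 0 z0).1.
rewrite E0 in H; apply: (is_derive_const_near (k := 0) e0 _ H) => s.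
by rewrite subr0; exact: D1.
Qed.

(* Non-divergence form [(1 - |grad u|^2) Lap u + Hess u (grad u, grad u)
   = 1 - |grad u|^2] of the translator equation, for the flat gradient [g] and the
   flat Hessian [B] at [p] of the homogeneous extension of [u]. *)
Definition translator_at p (g : 'cV[R]_n.+1) (B : 'M[R]_n.+1) : Prop :=
  let M := tmetric p in let N := (g^T *m M *m g) 0 0 in
  N < 1 /\ (1 - N) * \tr (M *m B) + ((M *m g)^T *m B *m (M *m g)) 0 0 = 1 - N.

(** Since [- <p + t v, p + t v> = 1 - 2 t <p,v> + O(t^2)], the differential of [hproj] at [p] is the
    orthogonal projection onto the tangent space. *)
Lemma is_derive_hproj p v i : hyp p ->
  is_derive (0 : R) 1 (fun t : R => hproj (p + t *: v) 0 i)
    ((v + lform p v *: p) 0 i).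
Proof.
move=> [pp _].
have dq : is_derive (0 : R) 1 (fun t : R => - lform (p + t *: v) (p + t *: v))
   (- (2 * lform p v)).
  have -> : (fun t : R => - lform (p + t *: v) (p + t *: v)) =
     (fun t => 1 + (- (2 * lform p v) * t + - lform v v * t ^+ 2)).
    by apply/funext => t; rewrite !lform_lin (lformC v p) pp; ring.
  have HH := is_derive_add (is_derive_cst1 1 0) (is_derive_add
    (is_derive_scale (- (2 * lform p v)) (is_derive_id1 0))
    (is_derive_scale (- lform v v) (is_derive_sqr (is_derive_id1 0)))).
  apply: (is_derive_eq HH).
  by ring.
have q0 : 0 < - lform (p + 0 *: v) (p + 0 *: v) by rewrite scale0r addr0 pp opprK.
have H1 := @is_derive_invsqrt (fun t => - lform (p + t *: v) (p + t *: v)) 0 _ q0 dq.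
have H2 := is_derive_affine_coord p v 0 i.
have -> : (fun t : R => hproj (p + t *: v) 0 i) =
  (fun t => (Num.sqrt (- lform (p + t *: v) (p + t *: v)))^-1 * (p + t *: v) 0 i).
  by apply/funext => t; rewrite /hproj mxE.
apply: (is_derive_eq (is_derive_mul H1 H2)).
by rewrite scale0r addr0 pp opprK sqrtr1 !mxE; field.
Qed.

Lemma lsign_cube (j : 'I_n.+1) (a : R) :
  lsign j * (lsign j * a) * (lsign j * a) = lsign j * a ^+ 2.
Proof. by rewrite [lsign j * (lsign j * a)]mulrA lsign_sqr mul1r mulrCA expr2. Qed.

Lemma hgrad_normsqE (u : 'rV[R]_n.+1 -> R) q :
  hgrad_normsq u q = ((partial_grad (hext u) q)^T *m eta *m partial_grad (hext u) q) 0 0.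
Proof.
rewrite /hgrad_normsq /lform mxE; apply: eq_bigr => j _.
by rewrite mul_etaE !mxE lsign_cube expr2 mulrA.
Qed.

Lemma tmetric_mul_tangent p (g : 'cV[R]_n.+1) : (p *m g) 0 0 = 0 ->
  tmetric p *m g = eta *m g.
Proof.
move=> pg; rewrite /tmetric mulmxDl -mulmxA [p *m g]mx11_scalar pg.
by rewrite mul_mx_scalar scale0r addr0.
Qed.

(** With [W^2 = 1 - N], the divergence expands to [tr (M B) / W + B (M g, M g) / W^3];
    multiplication by [W^3] then removes the square roots. *)
Lemma translator_atP (A : set 'rV[R]_n.+1) (u : 'rV[R]_n.+1 -> R) p :
  A `<=` hyp -> (forall x, (hproj @^-1` A) x -> nbhs x (hproj @^-1` A)) ->
  C2_on A u -> spacelike_translator A u -> A p ->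
  translator_at p (partial_grad (hext u) p) (hess (hext u) p).
Proof.
move=> Ah Uo CU [sp tr] Ap; have hp := Ah _ Ap.
set F := hext u; set g := partial_grad F p; set B := hess F p.
have Up : (hproj @^-1` A) p by rewrite /= hproj_id.
have [pg _] := hext_radial Uo CU Up.
have N1 := sp p Ap; have := tr p Ap.
set W := graph_W u p => trW.
have Mg := tmetric_mul_tangent pg.
have gE j : g j 0 = pderiv j F p by rewrite mxE.
have NE : hgrad_normsq u p = (g^T *m tmetric p *m g) 0 0.
  by rewrite hgrad_normsqE -[in RHS]mulmxA Mg mulmxA.
set N := hgrad_normsq u p in N1 NE.
have W0 : 0 < W by rewrite /W /graph_W sqrtr_gt0 subr_gt0.
have W2 : W ^+ 2 = 1 - N by rewrite sqr_sqrtr // subr_ge0 ltW.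
(* [hdiv] differentiates an extension, that is, along the projected curves [c i] below; [D i] is
   their velocity at [p]. *)
pose D i : 'rV[R]_n.+1 := delta_mx 0 i + lform p (delta_mx 0 i) *: p.
have DE i : D i = row i (eta *m tmetric p).
  rewrite /tmetric mulmxDr eta_sqr linearD /= row1; congr (_ + _).
  rewrite mulmxA row_mul rowE mulmxA [_ *m p^T]mx11_scalar mul_scalar_mx.
  by rewrite -lformE lformC.
pose c i (t : R) := hproj (p + t *: delta_mx 0 i).
have c0 i : c i 0 = p by rewrite /c scale0r addr0 hproj_id.
have dc i j : is_derive (0 : R) 1 (fun t => c i t 0 j) (D i 0 j).
  exact: is_derive_hproj.
have da i j : is_derive (0 : R) 1 (fun t => pderiv j F (c i t))
    ((eta *m tmetric p *m B) i j).
  have cU : nbhs (c i 0) (hproj @^-1` A) by rewrite c0; exact: Uo.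
  apply: (is_derive_eq (C1_chain (CU.2 j) cU (dc i))).
  rewrite c0 DE -row_mul mxE.
  by rewrite !mxE; apply: eq_bigr => k _; rewrite !mxE.
have dN i : is_derive (0 : R) 1 (fun t => hgrad_normsq u (c i t))
    (2 * (eta *m tmetric p *m B *m eta *m g) i 0).
  have -> : (fun t => hgrad_normsq u (c i t)) =
     (fun t => \sum_j lsign j * pderiv j F (c i t) ^+ 2).
    apply/funext => t; apply: eq_bigr => j _; by rewrite !mxE lsign_cube.
  have HS : is_derive (0 : R) 1 (fun t => \sum_j lsign j * pderiv j F (c i t) ^+ 2)
     (\sum_j lsign j * (2 * pderiv j F p * (eta *m tmetric p *m B) i j)).
    apply: (@is_derive_bigsum _ (fun j t => lsign j * pderiv j F (c i t) ^+ 2) 0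
      (fun j => lsign j * (2 * pderiv j F p * (eta *m tmetric p *m B) i j))) => j.
    have := is_derive_scale (lsign j) (is_derive_sqr (da i j)).
    by rewrite c0.
  apply: (is_derive_eq HS).
  rewrite [in RHS]mxE mulr_sumr; apply: eq_bigr => j _.
  move: (eta *m _ *m B) => X; rewrite -gE; move: (g j 0) => gj.
  by rewrite mul_mx_diag !mxE; ring.
have dV i : pderiv i (fun x => hext (fun q => (graph_W u q)^-1 *: hgrad u q) x 0 i) p =
   W^-1 * (lsign i * (eta *m tmetric p *m B) i i) +
   lsign i * g i 0 * ((eta *m tmetric p *m B *m eta *m g) i 0 / W ^+ 3).
  apply: derive_of_line.
  have H1 : is_derive (0 : R) 1 (fun t => 1 - hgrad_normsq u (c i t))
     (- (2 * (eta *m tmetric p *m B *m eta *m g) i 0)).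
    by apply: (is_derive_eq (is_derive_sub (is_derive_cst1 1 0) (dN i))); rewrite sub0r.
  have q0 : 0 < 1 - hgrad_normsq u (c i 0) by rewrite c0 subr_gt0.
  have H2 := @is_derive_invsqrt (fun t => 1 - hgrad_normsq u (c i t)) 0 _ q0 H1.
  have H3 := da i i.
  have -> : (fun t : R => hext (fun q => (graph_W u q)^-1 *: hgrad u q)
        (p + t *: basis_vec i) 0 i) =
      (fun t => (Num.sqrt (1 - hgrad_normsq u (c i t)))^-1 *
        (lsign i * pderiv i F (c i t))).
    by apply/funext => t; rewrite /hext /= !mxE.
  apply: (is_derive_eq (is_derive_mul H2 (is_derive_scale (lsign i) H3))).
  rewrite c0 -/(graph_W u p) -/W.
  rewrite gE.
  by field; rewrite gt_eqF.
rewrite /translator_at /= -NE; split=> //.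
move: trW; rewrite /hdiv (eq_bigr _ (fun i _ => dV i)) big_split /=.
have -> : \sum_(i < n.+1) W^-1 * (lsign i * (eta *m tmetric p *m B) i i) =
    W^-1 * \tr (tmetric p *m B).
  rewrite -mulr_sumr; congr (_ * _); apply: eq_bigr => i _.
  by rewrite -mulmxA {1}/eta mul_diag_mx !mxE mulrA lsign_sqr mul1r.
have -> : \sum_(i < n.+1) lsign i * g i 0 *
    ((eta *m tmetric p *m B *m eta *m g) i 0 / W ^+ 3) =
    ((tmetric p *m g)^T *m B *m (tmetric p *m g)) 0 0 / W ^+ 3.
  rewrite trmx_mul tmetric_tr Mg.
  have -> : g^T *m tmetric p *m B *m (eta *m g) =
     (g^T *m eta) *m (eta *m tmetric p *m B *m eta *m g).
    by rewrite -!mulmxA (mulmxA eta eta) eta_sqr mul1mx.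
  by rewrite mxE mulr_suml; apply: eq_bigr => i _; rewrite mul_etaE [g^T 0 i]mxE mulrA.
set T := \tr _; set Q := (_ *m _) 0 0 => E.
have : W ^+ 3 * (W^-1 * T + Q / W ^+ 3) = W ^+ 3 * W^-1 by rewrite E.
rewrite -W2; have W0' : W != 0 by rewrite gt_eqF.
have -> : W ^+ 3 * (W^-1 * T + Q / W ^+ 3) = W ^+ 2 * T + Q by field.
by move=> ->; field.
Qed.

End FlatCalculus.

(** * The inequality at a touching point and bounds on compact sets *)

Section Comparison.
Context {R : realType} {n : nat}.
Implicit Types (U A K : set 'rV[R]_n.+1) (u : 'rV[R]_n.+1 -> R) (p v : 'rV[R]_n.+1)
  (g : 'cV[R]_n.+1) (B X : 'M[R]_n.+1).

Lemma tmetric_quad S g : lorentz S ->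
  (g^T *m tmetric (row ord0 S) *m g) 0 0 =
    \sum_(k | k != ord0) (row k S *m g) 0 0 ^+ 2.
Proof.
move=> HS; rewrite tmetric_sum // mulmx_sumr mulmx_suml summxE.
apply: eq_bigr => k _; rewrite mulmxA -mulmxA -trmx_mul.
by rewrite [in LHS]mxE big_ord1 [in X in X * _]mxE expr2.
Qed.

Lemma tmetric_ge0 p g : hyp p -> 0 <= (g^T *m tmetric p *m g) 0 0.
Proof.
move=> hp; have [S HS <-] := hyp_frame hp; rewrite tmetric_quad //.
by apply: sumr_ge0 => k _; exact: sqr_ge0.
Qed.

(** The trace is the sum of the values of the quadratic form [X] on the space-like vectors of a
    frame at [p]. *)
Lemma tmetric_trace_le0 p X : hyp p ->
  (forall v, (v *m X *m v^T) 0 0 <= 0) -> \tr (tmetric p *m X) <= 0.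
Proof.
move=> hp HX; have [S HS <-] := hyp_frame hp; rewrite tmetric_sum //.
rewrite mulmx_suml raddf_sum /=; apply: sumr_le0 => k _.
rewrite -mulmxA mxtrace_mulC [X in \tr X]mx11_scalar mxtrace_scalar mulr1n.
exact: HX.
Qed.

(** Cauchy-Schwarz inequality for a semidefinite form: its value at [t g - e_i] is a nonnegative
    polynomial in [t] of degree at most 2. *)
Lemma tmetric_entry_sqr p g i : hyp p ->
  (tmetric p *m g) i 0 ^+ 2 <= tmetric p i i * (g^T *m tmetric p *m g) 0 0.
Proof.
move=> hp; set M := tmetric p; set N := (_ *m _) 0 0; set b := (M *m g) i 0.
have N0 : 0 <= N by exact: tmetric_ge0.
have H (t : R) : 0 <= N * t ^+ 2 - 2 * t * b + M i i.
  have := tmetric_ge0 (t *: g - delta_mx i 0) hp; rewrite -/M.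
  set di : 'rV[R]_n.+1 := delta_mx 0 i; set dj : 'cV[R]_n.+1 := delta_mx i 0.
  rewrite [(_ - _)^T]linearB /= linearZ /= trmx_delta -/di -/dj !mulmxBl !mulmxBr.
  rewrite -!scalemxAl -!scalemxAr -/M.
  have E1 : (di *m M *m g) 0 0 = b by rewrite -mulmxA /di -rowE mxE.
  have E2 : (g^T *m M *m dj) 0 0 = b.
    have -> : g^T *m M *m dj = (di *m M *m g)^T.
      by rewrite !trmx_mul /di trmx_delta -/dj tmetric_tr mulmxA.
    by rewrite mxE E1.
  have E3 : (di *m M *m dj) 0 0 = M i i.
    by rewrite /dj -colE /di -rowE !mxE.
  move: E1 E2 E3; rewrite /N.
  move: (di *m M *m g) (g^T *m M *m dj)
    (di *m M *m dj) (g^T *m M *m g) => a1 a2 a3 a4 E1 E2 E3 H.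
  rewrite !mxE E1 E2 E3 in H; rewrite (le_trans H) // le_eqVlt.
  by apply/orP; left; apply/eqP; ring.
have [N00|N00] := eqVneq N 0.
  rewrite N00 mulr0; suff -> : b = 0 by rewrite expr0n.
  apply/eqP; apply/negPn/negP => b0.
  (* For [N = 0] the polynomial is affine with slope [- 2 b]; this [t] would give it the value
     -1. *)
  have := H ((M i i + 1) / (2 * b)); rewrite N00 mul0r add0r.
  have -> : - (2 * ((M i i + 1) / (2 * b)) * b) + M i i = -1 by field.
  by rewrite lerNr oppr0 ler10.
have N1 : 0 < N by rewrite lt_neqAle eq_sym N00.
have := H (b / N).
have -> : N * (b / N) ^+ 2 - 2 * (b / N) * b + M i i = (M i i * N - b ^+ 2) / N by field.
by rewrite pmulr_lge0 ?invr_gt0 // subr_ge0.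
Qed.

(** By Cauchy-Schwarz and [M i i <= 1 + b^2], a product of two entries of [M g] is at most
    [(1 + b^2) N]. The factor [N] is essential: the term of the perturbation that absorbs this
    quantity also vanishes with the gradient. *)
Lemma quad_bound p g B (b : R) : hyp p -> (forall i, `|p 0 i| <= b) ->
  `|((tmetric p *m g)^T *m B *m (tmetric p *m g)) 0 0| <=
  (\sum_j \sum_i `|B i j|) * (1 + b ^+ 2) * (g^T *m tmetric p *m g) 0 0.
Proof.
move=> hp pb; set N := (g^T *m _ *m _) 0 0; set w := tmetric p *m g.
have N0 : 0 <= N by exact: tmetric_ge0.
have Mii i : tmetric p i i <= 1 + b ^+ 2.
  rewrite /tmetric !mxE big_ord1 !mxE eqxx mulr1n lerD //.
    by rewrite /lsign; case: ifP => _ //; lra.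
  have b0 : 0 <= b by rewrite (le_trans _ (pb i)).
  rewrite -expr2 -real_normK ?num_real //.
  by rewrite lerXn2r ?nnegrE.
have wi i : w i 0 ^+ 2 <= (1 + b ^+ 2) * N.
  by rewrite (le_trans (tmetric_entry_sqr g i hp)) // ler_wpM2r.
have wij i j : `|w i 0 * w j 0| <= (1 + b ^+ 2) * N.
  have H1 := wi i; have H2 := wi j.
  have H3 : 0 <= (w i 0 - w j 0) ^+ 2 by exact: sqr_ge0.
  have H4 : 0 <= (w i 0 + w j 0) ^+ 2 by exact: sqr_ge0.
  move: H3 H4; rewrite sqrrB sqrrD => H3 H4.
  by rewrite ler_norml; apply/andP; split; lra.
rewrite mxE -mulrA mulr_suml; apply: le_trans (ler_norm_sum _ _ _) _.
apply: ler_sum => j _; rewrite mxE !mulr_suml.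
apply: le_trans (ler_norm_sum _ _ _) _; apply: ler_sum => i _.
by rewrite [w^T 0 i]mxE mulrAC normrM mulrC ler_wpM2l.
Qed.

Lemma quad_form_lin v B X Y (a b : R) :
  (v *m (a *: B + b *: X - Y) *m v^T) 0 0 =
  a * (v *m B *m v^T) 0 0 + b * (v *m X *m v^T) 0 0 - (v *m Y *m v^T) 0 0.
Proof.
rewrite mulmxBr mulmxBl mulmxDr mulmxDl -!scalemxAr -!scalemxAl.
by move: (v *m B *m v^T) (v *m X *m v^T) (v *m Y *m v^T) => x y z; rewrite !mxE.
Qed.

Lemma quad_formZ v B (a : R) :
  ((a *: v) *m B *m (a *: v)^T) 0 0 = a ^+ 2 * (v *m B *m v^T) 0 0.
Proof.
rewrite linearZ /= -!scalemxAl -scalemxAr scalerA -expr2.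
by move: (v *m B *m v^T) => x; rewrite mxE.
Qed.

Lemma quad_form_outer v g : (v *m (g *m g^T) *m v^T) 0 0 = (v *m g) 0 0 ^+ 2.
Proof.
rewrite mulmxA -mulmxA -trmx_mul; move: (v *m g) => x.
by rewrite mxE big_ord1 mxE expr2.
Qed.

Lemma quad_form_lin_outer v g B Y (a b : R) :
  (v *m (a *: B + b *: (g *m g^T) - Y) *m v^T) 0 0 =
  a * (v *m B *m v^T) 0 0 + b * (v *m g) 0 0 ^+ 2 - (v *m Y *m v^T) 0 0.
Proof. by rewrite quad_form_lin quad_form_outer. Qed.

(* With [k = 1 + d], [N = g1^T M g1] and [Q = (M g1)^T B1 (M g1)], the two
   translator equations and the semidefiniteness hypothesis combine into
   [(1 - N) ((1 - k^2 N) + 6 C N) + k (2 + d) Q <= 0]. *)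
Lemma translator_touching p g1 B1 g2 B2 (d C : R) : hyp p ->
  translator_at p g1 B1 -> translator_at p g2 B2 -> 0 < d -> d <= 1 ->
  g2 = (1 + d) *: g1 -> 0 <= C ->
  `|((tmetric p *m g1)^T *m B1 *m (tmetric p *m g1)) 0 0| <=
    C * (g1^T *m tmetric p *m g1) 0 0 * (1 - (g1^T *m tmetric p *m g1) 0 0) ->
  ~ (forall v, (v *m ((1 + d) *: B1 + (6 * C * d) *: (g1 *m g1^T) - B2) *m v^T) 0 0 <= 0).
Proof.
move=> hp; rewrite /translator_at /=; set M := tmetric p.
move=> [N1 E1] [N2 E2] d0 d1 g2E C0 QC HX.
(* The semidefinite inequality is used in trace and in the direction of the gradient; with the
   weights [1 - N2] and 1 the two results add up to the operator of the second equation. *)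
have I1 := tmetric_trace_le0 hp HX; have I2 := HX (M *m g2)^T.
rewrite -/M in I1; rewrite quad_form_lin trmxK in I2.
set N := (g1^T *m M *m g1) 0 0 in N1 E1 QC *.
set Q := ((M *m g1)^T *m B1 *m (M *m g1)) 0 0 in E1 QC *.
have N0 : 0 <= N by exact: tmetric_ge0.
have N2E : (g2^T *m M *m g2) 0 0 = (1 + d) ^+ 2 * N.
  by rewrite g2E -{2}[(1 + d) *: g1]trmxK linearZ /= quad_formZ trmxK.
rewrite N2E in N2 E2.
set Q2 := ((M *m g2)^T *m B2 *m (M *m g2)) 0 0 in E2 I2 *.
have tG : \tr (M *m (g1 *m g1^T)) = N.
  by rewrite mulmxA mxtrace_mulC mulmxA [X in \tr X]mx11_scalar mxtrace_scalar mulr1n.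
have {}I1 : (1 + d) * \tr (M *m B1) + 6 * C * d * N - \tr (M *m B2) <= 0.
  move: I1; rewrite mulmxBr mulmxDr -!scalemxAr raddfB /= raddfD /=.
  by rewrite !mxtraceZ tG.
have QE : ((M *m g2)^T *m B1 *m (M *m g2)) 0 0 = (1 + d) ^+ 2 * Q.
  have := quad_formZ (M *m g1)^T B1 (1 + d).
  by rewrite g2E -scalemxAr !linearZ /= trmxK.
have GE : ((M *m g2)^T *m (g1 *m g1^T) *m (M *m g2)) 0 0 = (1 + d) ^+ 2 * N ^+ 2.
  have := quad_form_outer (M *m g2)^T g1; rewrite trmxK => ->.
  rewrite trmx_mul tmetric_tr g2E linearZ /= -!scalemxAl mxE -/N exprMn.
  by [].
rewrite QE GE in I2.
have T1 : \tr (M *m B1) * (1 - N) = 1 - N - Q by lra.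
set T := \tr (M *m B1) in I1 T1; set T2 := \tr (M *m B2) in I1 E2.
set k := 1 + d in N2 E2 I1 I2 *; have k1 : 1 < k by rewrite /k; lra.
have kd : k ^+ 2 - 1 = d * (2 + d) by rewrite /k; ring.
have H1 : (1 - k ^+ 2 * N) * (k * T + 6 * C * d * N - T2) <= 0.
  by apply: mulr_ge0_le0 => //; lra.
have H2 : (1 - k ^+ 2 * N) * (k * T + 6 * C * d * N) +
    (k * (k ^+ 2 * Q) + 6 * C * d * (k ^+ 2 * N ^+ 2)) - (1 - k ^+ 2 * N) <= 0.
  have : (1 - k ^+ 2 * N) * T2 = 1 - k ^+ 2 * N - Q2 by lra.
  by move: H1 I2; rewrite mulrBr; lra.
have N3 : 0 < 1 - N by lra.
(* The factor [1 - N] lets the first equation eliminate [T]; a factor [d] then comes out of every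
   term. *)
have H3 : (1 - N) * (d * ((1 - k ^+ 2 * N) + 6 * C * N)) + k * (d * (2 + d)) * Q <= 0.
  have := mulr_ge0_le0 (ltW N3) H2; rewrite -kd.
  set L := (X in X <= 0) => HL; set L' := (X in X <= 0).
  suff -> : L' = L by [].
  transitivity (L + (1 - k ^+ 2 * N) * k * ((1 - N - Q) - T * (1 - N))); last first.
    by rewrite T1 subrr mulr0 addr0.
  by rewrite /L' /L /k; ring.
have H4 : d * ((1 - N) * ((1 - k ^+ 2 * N) + 6 * C * N) + k * (2 + d) * Q) <= 0.
  by move: H3; apply: le_trans; rewrite le_eqVlt; apply/orP; left; apply/eqP; ring.
rewrite pmulr_rle0 // in H4.
(* The constant 6 bounds [k (2 + d)], as [k <= 2] and [2 + d <= 3]. *)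
have H5 : `|k * (2 + d) * Q| <= 6 * (C * N * (1 - N)).
  have k2 : 0 <= k * (2 + d) by rewrite mulr_ge0 /k //; lra.
  rewrite normrM (ger0_norm k2); apply: ler_pM => //.
  have -> : 6 = 2 * 3 :> R by ring.
  by apply: ler_pM; rewrite /k; lra.
have H6 : 0 < (1 - N) * (1 - k ^+ 2 * N) by rewrite mulr_gt0 //; lra.
move: H5; rewrite ler_norml => /andP[H5 _].
have E3 : (1 - N) * ((1 - k ^+ 2 * N) + 6 * C * N) =
  (1 - N) * (1 - k ^+ 2 * N) + 6 * (C * N * (1 - N)) by ring.
by rewrite E3 in H4; lra.
Qed.

Lemma compact_within_superlevel K (f : 'rV[R]_n.+1 -> R) (a : R) : compact K ->
  {within K, continuous f} -> compact (K `&` [set x | a <= f x]).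
Proof.
move=> Kc /continuous_closedP/(_ _ (@closed_ge R a))/closed_subspaceP[V Vc VK].
rewrite setIC; have -> : [set x | a <= f x] `&` K = K `&` V by rewrite [RHS]setIC VK.
exact: compact_closedI.
Qed.

Lemma compact_within_bound K (f : 'rV[R]_n.+1 -> R) : compact K ->
  {within K, continuous f} -> exists2 b, 0 <= b & forall p, K p -> f p <= b.
Proof.
move=> Kc fc; have [->|/set0P[x0 Kx0]] := eqVneq K set0; first by exists 0.
have [c _ cmax] := compact_EVT_max (ex_intro _ x0 Kx0) Kc fc.
exists (Num.max 0 (f c)); first by rewrite le_max lexx.
by move=> p Kp; rewrite le_max (cmax p) ?orbT // inE.
Qed.

Lemma compact_bound K (f : 'rV[R]_n.+1 -> R) : compact K ->
  (forall p, K p -> {for p, continuous f}) ->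
  exists2 b, 0 <= b & forall p, K p -> `|f p| <= b.
Proof.
move=> Kc fc; have fK : {within K, continuous (fun x => `|f x|)}.
  apply: continuous_in_subspaceT => x; rewrite inE => Kx.
  by apply: (@continuous_comp _ _ _ f (fun y => `|y|)); [exact: fc|exact: norm_continuous].
exact: compact_within_bound fK.
Qed.

(** The operator degenerates as [N] tends to 1. Compactness of [K] inside [A] bounds [(1 - N)^-1]
    along with the Hessian, which supplies the factor [1 - N] on the right. *)
Lemma quad_bound_compact A u K : A `<=` hyp ->
  (forall x, (hproj @^-1` A) x -> nbhs x (hproj @^-1` A)) -> C2_on A u ->
  (forall p, A p -> translator_at p (partial_grad (hext u) p) (hess (hext u) p)) ->
  compact K -> K `<=` A ->
  exists2 C, 0 < C & forall p, K p ->
    let g := partial_grad (hext u) p in let N := (g^T *m tmetric p *m g) 0 0 in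
    `|((tmetric p *m g)^T *m hess (hext u) p *m (tmetric p *m g)) 0 0| <= C * N * (1 - N).
Proof.
move=> Ah Uo CU TR Kc KA; set F := hext u.
have UK p : K p -> (hproj @^-1` A) p by move=> Kp; rewrite /= hproj_id; [exact: KA|exact/Ah/KA].
have NE p : K p -> hgrad_normsq u p = ((partial_grad F p)^T *m tmetric p *m partial_grad F p) 0 0.
  move=> Kp; have [pg _] := hext_radial Uo CU (UK p Kp).
  by rewrite hgrad_normsqE -[in RHS]mulmxA (tmetric_mul_tangent pg) mulmxA.
have cg i p : K p -> {for p, continuous (pderiv i F)}.
  by move=> Kp; have [] := CU.1 p (UK p Kp) i.
have ch j i p : K p -> {for p, continuous (pderiv j (pderiv i F))}.
  by move=> Kp; have [] := CU.2 i p (UK p Kp) j.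
have cN p : K p -> {for p, continuous (hgrad_normsq u)}.
  move=> Kp; have -> : hgrad_normsq u = fun q => \sum_j lsign j * (pderiv j F q * pderiv j F q).
    by apply/funext => q; apply: eq_bigr => j _; rewrite !mxE lsign_cube expr2.
  have FF : Filter (nbhs p) := nbhs_filter p.
  apply: cvg_big => [|j _]; first exact: add_continuous.
  apply: (@continuousM _ _ (fun=> lsign j) (fun q => pderiv j F q * pderiv j F q)).
    exact: cst_continuous.
  by apply: continuousM; exact: cg.
have [c1 c10 Hc1] : exists2 c, 0 <= c & forall p, K p -> `|(1 - hgrad_normsq u p)^-1| <= c.
  apply: compact_bound => // p Kp; apply: continuousV.
    by rewrite NE //; have [N1 _] := TR p (KA p Kp); rewrite gt_eqF // subr_gt0.
  by apply: continuousB; [exact: cst_continuous|exact: cN].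
have cb i : exists2 b, 0 <= b & forall p, K p -> `|p 0 i| <= b.
  by apply: compact_bound => // p _; exact: coord_continuous.
have hb j i : exists2 b, 0 <= b & forall p, K p -> `|pderiv j (pderiv i F) p| <= b.
  by apply: compact_bound => // p Kp; exact: ch.
pose b i := sval (cid2 (cb i)).
have b0 i : 0 <= b i by rewrite /b; case: cid2.
have bP i p : K p -> `|p 0 i| <= b i by rewrite /b; case: cid2 => /= x _; apply.
pose h j i := sval (cid2 (hb j i)).
have h0 j i : 0 <= h j i by rewrite /h; case: cid2.
have hP j i p : K p -> `|pderiv j (pderiv i F) p| <= h j i.
  by rewrite /h; case: cid2 => /= x _; apply.
pose bb := \sum_i b i; pose hh := \sum_i \sum_j h j i.
have bb0 : 0 <= bb by apply: sumr_ge0.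
have hh0 : 0 <= hh by apply: sumr_ge0 => i _; apply: sumr_ge0.
(* The summand 1 keeps the constant positive, since the perturbation divides by a multiple of it. *)
exists (hh * (1 + bb ^+ 2) * c1 + 1).
  by rewrite ltr_wpDl // !mulr_ge0 // addr_ge0 ?sqr_ge0.
move=> p Kp /=; have hp := Ah p (KA p Kp); have [N1 _] := TR p (KA p Kp).
have N0 := tmetric_ge0 (partial_grad F p) hp.
have cc := Hc1 p Kp; rewrite NE // in cc.
set N := (_ *m _ *m partial_grad F p) 0 0 in N0 N1 cc *.
have pb i : `|p 0 i| <= bb.
  rewrite (le_trans (bP i p Kp)) // /bb (bigD1 i) //= lerDl; exact: sumr_ge0.
apply: le_trans (quad_bound _ _ hp pb) _.
rewrite -/N.
have N3 : 0 < 1 - N by rewrite subr_gt0.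
have one : 1 <= c1 * (1 - N).
  by rewrite -ler_pdivrMr // mul1r (le_trans (ler_norm _)).
have S1 : \sum_j \sum_i `|hess F p i j| <= hh.
  by apply: ler_sum => j _; apply: ler_sum => i _; rewrite mxE hP.
have P0 : 0 <= hh * (1 + bb ^+ 2) * N by rewrite !mulr_ge0 // addr_ge0 ?sqr_ge0.
apply: (@le_trans _ _ (hh * (1 + bb ^+ 2) * N)).
  by rewrite !ler_wpM2r // addr_ge0 ?sqr_ge0.
apply: (@le_trans _ _ (hh * (1 + bb ^+ 2) * N * (c1 * (1 - N)))).
  by rewrite ler_peMr.
rewrite -subr_ge0 (_ : _ - _ = N * (1 - N)); first by rewrite mulr_ge0 // ltW.
by ring.
Qed.

End Comparison.

(** * Comparison principle for translators *)

Section ComparisonPrinciple.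
Context {R : realType} {n : nat}.
Implicit Types (A K : set 'rV[R]_n.+1) (u : 'rV[R]_n.+1 -> R) (p v x : 'rV[R]_n.+1).

Lemma hext_hyp u p : hyp p -> hext u p = u p.
Proof. by move=> hp; rewrite /hext /= hproj_id. Qed.

Lemma near_line A x v : nbhs x A -> exists2 e, 0 < e & forall t : R, `|t| < e -> A (x + t *: v).
Proof.
move=> /nbhs_ballP[d /= d0 dA]; have v1 : 0 < `|v| + 1 by rewrite ltr_wpDl.
exists (d / (`|v| + 1)); first by rewrite divr_gt0.
move=> t; rewrite ltr_pdivlMr // => td; apply: dA.
rewrite -ball_normE /ball_ /= opprD addrA subrr sub0r normrN normrZ.
by rewrite (le_lt_trans _ td) // ler_wpM2l // lerDl.
Qed.

(* [u1 + e exp (a u1)] is a strict subsolution near the set where [u1 - u2] is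
   large, so it cannot touch [u2] from below after a vertical translation. *)
Theorem translator_comparison A K u1 u2 :
  A `<=` hyp -> (forall x, (hproj @^-1` A) x -> nbhs x (hproj @^-1` A)) ->
  compact K -> A `<=` K ->
  {within K, continuous u1} -> {within K, continuous u2} ->
  C2_on A u1 -> C2_on A u2 ->
  (forall p, A p -> translator_at p (partial_grad (hext u1) p) (hess (hext u1) p)) ->
  (forall p, A p -> translator_at p (partial_grad (hext u2) p) (hess (hext u2) p)) ->
  (forall p, K p -> ~ A p -> u1 p <= u2 p) ->
  forall p, K p -> u1 p <= u2 p.
Proof.
move=> Ah Uo Kc AK cu1 cu2 CU1 CU2 TR1 TR2 bd p0 Kp0.
rewrite leNgt; apply/negP => lt12.
pose m := u1 p0 - u2 p0; have m0 : 0 < m by rewrite subr_gt0.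
have cd : {within K, continuous (fun x => u1 x - u2 x)}.
  by move=> x; apply: continuousB; [exact: cu1|exact: cu2].
(* This set will contain the touching point for every admissible [e], and it lies in [A] because
   [u1 <= u2] elsewhere on [K]. *)
pose K' := K `&` [set x | m / 2 <= u1 x - u2 x].
have K'c : compact K' by exact: compact_within_superlevel.
have K'A : K' `<=` A.
  move=> x [Kx /= mx]; apply: contrapT => nAx.
  by have := bd x Kx nAx; lra.
have [C C0 HC] := quad_bound_compact Ah Uo CU1 TR1 K'c K'A.
have [L _ HL] := compact_within_bound Kc cu1.
pose a := 6 * C; have a0 : 0 < a by rewrite mulr_gt0.
(* The exponential normalizes [exp (a u1)] to at most 1 on [K]. The two bounds then keep the
   perturbation below [m / 4] and its derivative [d] below 1. *)
pose e := Num.min (m / 4) a^-1 * expR (- (a * L)).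
have mn0 : 0 < Num.min (m / 4) a^-1 by rewrite lt_min invr_gt0 a0 divr_gt0.
have e0 : 0 < e by rewrite mulr_gt0 // expR_gt0.
have eb x : K x -> e * expR (a * u1 x) <= Num.min (m / 4) a^-1.
  move=> Kx; rewrite /e -mulrA -expRD; apply: ler_piMr; first exact: ltW.
  rewrite -[leRHS]expR0 ler_expR -mulrN -mulrDr pmulr_rle0 //.
  by rewrite addrC subr_le0 HL.
have eb1 x : K x -> e * expR (a * u1 x) <= m / 4.
  by move=> /eb; rewrite le_min => /andP[].
have eb2 x : K x -> e * expR (a * u1 x) * a <= 1.
  by move=> /eb; rewrite le_min => /andP[_ H]; rewrite -(ler_pdivlMr _ _ a0) div1r.
pose D x := u1 x + e * expR (a * u1 x) - u2 x.
pose phi (y : R) := y + e * expR (a * y).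
have cphi : continuous phi.
  have cE : continuous (fun y : R => e * expR (a * y)).
    move=> y; apply: (@continuousM _ _ (fun=> e) (fun y => expR (a * y))); first exact: cst_continuous.
    apply: (@continuous_comp _ _ _ (fun y => a * y) expR); last exact: continuous_expR.
    by apply: (@continuousM _ _ (fun=> a) (fun y => y)); first exact: cst_continuous.
  by move=> y; apply: cvgD; [exact: cvg_id|exact: cE].
have cphiu : {within K, continuous (phi \o u1)}.
  by apply: within_continuous_comp => // y _; exact: cphi.
have cD : {within K, continuous (fun x => (phi \o u1) x - u2 x)}.
  by move=> x; apply: continuousB; [exact: cphiu|exact: cu2].
have [p] := @compact_EVT_max _ _ D _ (ex_intro _ p0 Kp0) Kc cD.
rewrite inE => Kp pmax.
(* The maximum of [D] exceeds [D p0 - e exp (a u1 p0) = m], and the perturbation accounts for at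
   most [m / 4] of it. *)
have pK' : K' p.
  split=> //=; have := pmax p0; rewrite inE => /(_ Kp0); rewrite /D => H.
  have := eb1 p Kp; have : 0 < e * expR (a * u1 p0) by rewrite mulr_gt0 // expR_gt0.
  by rewrite /m in m0 *; lra.
have Ap := K'A p pK'; have hp := Ah p Ap.
(* At [u1 p] the function [phi] has first derivative [1 + d] and second derivative [a d = 6 C d]. *)
pose d := e * expR (a * u1 p) * a.
have d0 : 0 < d by rewrite !mulr_gt0 // expR_gt0.
have d1 : d <= 1 by exact: eb2.
have Up : (hproj @^-1` A) p by rewrite /= hproj_id.
have alg (y1 y2 b1 b2 E : R) : y1 + e * (E * (a * y1)) - y2 = 0 ->
    b1 + e * (E * (a * b1) + a * y1 * (E * (a * y1))) - b2 <= 0 ->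
    y2 = (1 + e * E * a) * y1 /\
    (1 + e * E * a) * b1 + 6 * C * (e * E * a) * y1 ^+ 2 - b2 <= 0.
  move=> H1 H2; split; first by rewrite -[LHS]addr0 -H1; ring.
  by move: H2; apply: le_trans; rewrite le_eqVlt; apply/orP; left; apply/eqP; rewrite /a; ring.
have key v :
   (v *m partial_grad (hext u2) p) 0 0 = (1 + d) * (v *m partial_grad (hext u1) p) 0 0 /\
   (v *m ((1 + d) *: hess (hext u1) p +
      (6 * C * d) *: (partial_grad (hext u1) p *m (partial_grad (hext u1) p)^T)
      - hess (hext u2) p) *m v^T) 0 0 <= 0.
  have [e1 e10 He1] := near_line v (Uo _ Up).
  pose f t := hext u1 (p + t *: v) + e * expR (a * hext u1 (p + t *: v))
    - hext u2 (p + t *: v).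
  pose G1 t := (v *m partial_grad (hext u1) (p + t *: v)) 0 0.
  pose G2 t := (v *m partial_grad (hext u2) (p + t *: v)) 0 0.
  pose f' t := G1 t + e * (expR (a * hext u1 (p + t *: v)) * (a * G1 t)) - G2 t.
  have dE (t : R) : `|t| < e1 -> is_derive t 1 (fun t => expR (a * hext u1 (p + t *: v)))
      (expR (a * hext u1 (p + t *: v)) * (a * G1 t)).
    move=> te; have tU := Uo _ (He1 t te).
    exact: (is_derive_comp (is_derive_expR _) (is_derive_scale a (C1_line CU1.1 tU))).
  have df (t : R) : `|t| < e1 -> is_derive t 1 f (f' t).
    move=> te; have tU := Uo _ (He1 t te).
    apply: is_derive_sub; last exact: (C1_line CU2.1 tU).
    apply: is_derive_add; first exact: (C1_line CU1.1 tU).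
    by apply: is_derive_scale; exact: dE.
  have z0 : `|0 : R| < e1 by rewrite normr0.
  have tU := Uo _ (He1 0 z0).
  have E0 : p + 0 *: v = p by rewrite scale0r addr0.
  have df' := is_derive_sub (is_derive_add (C2_line CU1 tU) (is_derive_scale e
     (is_derive_mul (dE 0 z0) (is_derive_scale a (C2_line CU1 tU))))) (C2_line CU2 tU).
  (* The line leaves the hyperboloid, but the extensions take at [p + t v] the values of the
     functions at its radial projection, which lies in [A]. *)
  have fmax t : `|t| < e1 -> f t <= f 0.
    move=> te; have At := He1 t te.
    have := pmax (hproj (p + t *: v)); rewrite inE => /(_ (AK _ At)).
    by rewrite /f /D E0 !(hext_hyp _ hp).
  have [f'0 bneg] := second_derivative_test e10 df df' fmax.
  have F1p : hext u1 p = u1 p by exact: hext_hyp.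
  rewrite /f' /G1 /G2 E0 F1p in f'0; rewrite /G1 E0 F1p in bneg.
  have [H1 H2] := alg _ _ _ _ _ f'0 bneg; split; first exact: H1.
  rewrite quad_form_lin_outer; exact: H2.
have gE : partial_grad (hext u2) p = (1 + d) *: partial_grad (hext u1) p.
  apply/colP => i; have [H _] := key (delta_mx 0 i).
  by move: H; rewrite -!rowE ![row _ _ _ _]mxE => ->; rewrite [RHS]mxE.
apply: (translator_touching hp (TR1 p Ap) (TR2 p Ap) d0 d1 gE (ltW C0)).
  exact: HC.
by move=> v; have [] := key v.
Qed.

End ComparisonPrinciple.

(** * Lorentz invariance of the equation *)

Section LorentzInvariance.
Context {R : realType} {n : nat}.
Implicit Types (A : set 'rV[R]_n.+1) (u F : 'rV[R]_n.+1 -> R) (p x : 'rV[R]_n.+1)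
  (S : 'M[R]_n.+1).

Lemma mulmx_continuous S : continuous (fun x : 'rV[R]_n.+1 => x *m S).
Proof.
move=> x; have FF : Filter (nbhs x) := nbhs_filter x.
apply/cvgrPdist_lt => e e0.
have H j : nbhs x [set y | `|(x *m S) 0 j - (y *m S) 0 j| < e].
  have E y : (y *m S) 0 j = colform (col j S) y.
    by rewrite /colform !mxE; apply: eq_bigr => k _; rewrite !mxE.
  have /cvgrPdist_lt/(_ e e0) := @colform_continuous _ _ (col j S) x.
  by apply: filterS => y; rewrite /= !E.
apply: filterS (filter_forall FF H) => y Hy.
rewrite [ltLHS]/Num.Def.normr /= mx_normrE bigmax_lt // => -[i j] _ /=.
by rewrite ord1; have := Hy j; rewrite /= !mxE.
Qed.

Lemma continuous_near_eq A (f g : 'rV[R]_n.+1 -> R) x : nbhs x A ->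
  (forall y, A y -> f y = g y) -> {for x, continuous g} -> {for x, continuous f}.
Proof.
move=> xA fg cg B; rewrite /continuous_at (fg x (nbhs_singleton xA)) => /cg gB.
have FF : Filter (nbhs x) := nbhs_filter x.
suff : nbhs x (f @^-1` B) by [].
apply: (@filterS _ (nbhs x) FF (A `&` (g @^-1` B))); last exact: filterI.
by move=> y [Ay] /=; rewrite fg.
Qed.

Lemma derivable_of_line (f : 'rV[R]_n.+1 -> R) x v (l : R) :
  is_derive (0 : R) 1 (fun t => f (x + t *: v)) l -> derivable f x v.
Proof.
move=> [D _]; apply/derivable1P.
by have -> : (fun h : R => f (h *: v + x)) = (fun t => f (x + t *: v))
  by apply/funext => h; rewrite addrC.
Qed.

Section Pullback.
Variables (U : set 'rV[R]_n.+1) (S : 'M[R]_n.+1).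
Hypothesis Uo : forall x, U x -> nbhs x U.
Hypothesis US : forall x, U x -> U (x *m S).

Lemma pderiv_mul F x i : C1_flat U F -> U x ->
  is_derive (0 : R) 1 (fun t => F ((x + t *: delta_mx 0 i) *m S))
    ((row i S *m partial_grad F (x *m S)) 0 0).
Proof.
move=> CF Ux; have -> : (fun t : R => F ((x + t *: delta_mx 0 i) *m S)) =
  (fun t => F (x *m S + t *: row i S)).
  by apply/funext => t; rewrite mulmxDl -scalemxAl -rowE.
have E0 : x *m S + 0 *: row i S = x *m S by rewrite scale0r addr0.
have := @C1_line _ _ U F (x *m S) (row i S) 0 CF; rewrite E0; apply.
exact/Uo/US.
Qed.

Lemma partial_grad_mul F x : C1_flat U F -> U x ->
  partial_grad (fun y => F (y *m S)) x = S *m partial_grad F (x *m S).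
Proof.
move=> CF Ux; apply/colP => i; rewrite mxE (derive_of_line (pderiv_mul i CF Ux)).
by rewrite -row_mul mxE.
Qed.

Lemma C1_flat_mul F : C1_flat U F -> C1_flat U (fun y => F (y *m S)).
Proof.
move=> CF x Ux i; split; first exact: derivable_of_line (pderiv_mul i CF Ux).
apply: (continuous_near_eq (g := fun y => \sum_k S i k * pderiv k F (y *m S)) (Uo Ux)).
  move=> y Uy; rewrite /pderiv (derive_of_line (pderiv_mul i CF Uy)) mxE.
  by apply: eq_bigr => k _; rewrite !mxE.
have H k : {for x, continuous (fun y : 'rV[R]_n.+1 => S i k * pderiv k F (y *m S))}.
apply: (@continuousM _ _ (fun=> S i k) (fun y : 'rV[R]_n.+1 => pderiv k F (y *m S))).
  exact: cst_continuous.
apply: (@continuous_comp _ _ _ (fun y : 'rV[R]_n.+1 => y *m S) (pderiv k F)).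
  exact: mulmx_continuous.
by have [] := CF _ (US Ux) k.
have FF : Filter (nbhs x) := nbhs_filter x.
by apply: cvg_big => [|k _]; [exact: add_continuous|exact: H].
Qed.

Lemma C1_flat_ext (F1 F2 : 'rV[R]_n.+1 -> R) : (forall x, U x -> F1 x = F2 x) ->
  C1_flat U F2 ->
  C1_flat U F1 /\ forall i x, U x -> pderiv i F1 x = pderiv i F2 x.
Proof.
move=> F12 CF; have E i x : U x -> pderiv i F1 x = pderiv i F2 x.
  move=> Ux; apply: near_eq_derive.
  by apply: filterS (Uo Ux) => y; exact: F12.
split=> // x Ux i; have [D1 D2] := CF x Ux i; split.
  apply: near_eq_derivable D1.
  by apply: filterS (Uo Ux) => y /F12.
by apply: continuous_near_eq (Uo Ux) _ D2 => y; exact: E.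
Qed.

Lemma C1_flat_lincomb (a : 'I_n.+1 -> R) (G : 'I_n.+1 -> 'rV[R]_n.+1 -> R) :
  (forall k, C1_flat U (G k)) ->
  C1_flat U (fun y => \sum_k a k * G k y) /\
  forall i x, U x -> pderiv i (fun y => \sum_k a k * G k y) x =
    \sum_k a k * pderiv i (G k) x.
Proof.
move=> CG; have D i x : U x -> is_derive (0 : R) 1
   (fun t => \sum_k a k * G k (x + t *: delta_mx 0 i)) (\sum_k a k * pderiv i (G k) x).
  move=> Ux; apply: is_derive_bigsum => k; apply: is_derive_scale.
  have := @C1_line _ _ U (G k) x (delta_mx 0 i) 0 (CG k).
  rewrite scale0r addr0 => /(_ (Uo Ux)) H; apply: (is_derive_eq H).
  by rewrite -rowE !mxE.
have E i x : U x -> pderiv i (fun y => \sum_k a k * G k y) x = \sum_k a k * pderiv i (G k) x.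
  by move=> Ux; exact: derive_of_line (D i x Ux).
split=> // x Ux i; split; first exact: derivable_of_line (D i x Ux).
apply: (continuous_near_eq (Uo Ux) (E i)).
have FF : Filter (nbhs x) := nbhs_filter x.
apply: cvg_big => [|k _]; first exact: add_continuous.
apply: (@continuousM _ _ (fun=> a k) (pderiv i (G k))); first exact: cst_continuous.
by have [] := CG k x Ux i.
Qed.

(** On [U] the partial derivatives of the pullback are constant combinations of pulled back partial
    derivatives, so the first order statements can be applied once more. *)
Lemma C2_flat_mul F : C2_flat U F ->
  C2_flat U (fun y => F (y *m S)) /\
  forall x, U x -> hess (fun y => F (y *m S)) x = S *m hess F (x *m S) *m S^T.
Proof.
move=> [CF CCF]; have C1 := C1_flat_mul CF.
have L i := C1_flat_lincomb (S i) (fun k => C1_flat_mul (CCF k)).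
have E i x : U x -> pderiv i (fun y => F (y *m S)) x = \sum_k S i k * pderiv k F (x *m S).
  move=> Ux; rewrite /pderiv (derive_of_line (pderiv_mul i CF Ux)) mxE.
  by apply: eq_bigr => k _; rewrite !mxE.
have X i := C1_flat_ext (E i) (L i).1.
split; first by split; [exact: C1|move=> i; exact: (X i).1].
move=> x Ux; apply/matrixP => j i.
have -> : hess (fun y => F (y *m S)) x j i = pderiv j (pderiv i (fun y => F (y *m S))) x.
  by rewrite mxE.
rewrite ((X i).2 j x Ux) ((L i).2 j x Ux) [RHS]mxE.
apply: eq_bigr => k _; rewrite [S^T k i]mxE mulrC; congr (_ * _).
rewrite /pderiv (derive_of_line (pderiv_mul j (CCF k) Ux)) mxE [RHS]mxE.
by apply: eq_bigr => l _; rewrite !mxE.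
Qed.

End Pullback.

(** The point enters only through [tmetric], which transforms by congruence; the trace term is then
    invariant by cyclicity. *)
Lemma translator_at_mul p S (g : 'cV[R]_n.+1) (B : 'M[R]_n.+1) : lorentz S ->
  translator_at (p *m S) g B -> translator_at p (S *m g) (S *m B *m S^T).
Proof.
move=> HS; rewrite /translator_at /= -(tmetric_mul p HS).
set M := tmetric p.
have -> : g^T *m (S^T *m M *m S) *m g = (S *m g)^T *m M *m (S *m g).
  by rewrite trmx_mul !mulmxA.
have -> : \tr (S^T *m M *m S *m B) = \tr (M *m (S *m B *m S^T)).
  by rewrite -!mulmxA mxtrace_mulC !mulmxA.
have -> // : (S^T *m M *m S *m g)^T *m B *m (S^T *m M *m S *m g) =
   (M *m (S *m g))^T *m (S *m B *m S^T) *m (M *m (S *m g)).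
by rewrite !trmx_mul !trmxK !mulmxA.
Qed.

Lemma hext_mul u S : lorentz S ->
  hext (fun p => u (p *m S)) = fun x => hext u (x *m S).
Proof. by move=> HS; apply/funext => x; rewrite /hext /= hproj_mul. Qed.

Lemma translator_mul A u S : lorentz S -> A `<=` hyp ->
  (forall x, (hproj @^-1` A) x -> nbhs x (hproj @^-1` A)) ->
  (forall p, A p -> A (p *m S)) -> C2_on A u ->
  (forall p, A p -> translator_at p (partial_grad (hext u) p) (hess (hext u) p)) ->
  C2_on A (fun p => u (p *m S)) /\
  forall p, A p -> translator_at p (partial_grad (hext (fun p => u (p *m S))) p)
    (hess (hext (fun p => u (p *m S))) p).
Proof.
move=> HS Ah Uo AS CU TR; rewrite /C2_on (hext_mul u HS).
have US x : (hproj @^-1` A) x -> (hproj @^-1` A) (x *m S).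
  by rewrite /= hproj_mul //; exact: AS.
have [C2 HE] := C2_flat_mul Uo US CU; split; first exact: C2.
move=> p Ap.
have Up : (hproj @^-1` A) p by rewrite /= hproj_id; [exact: Ap|exact: Ah].
rewrite (HE p Up) (partial_grad_mul Uo US CU.1 Up).
exact: (translator_at_mul HS (TR _ (AS p Ap))).
Qed.

End LorentzInvariance.

(** * Rotational symmetry by reflection *)

Section RotationalSymmetry.
Context {R : realType} {n : nat}.
Implicit Types (u : 'rV[R]_n.+1 -> R) (c p q : 'rV[R]_n.+1) (r : R).

Lemma closure_mul (A : set 'rV[R]_n.+1) (S : 'M[R]_n.+1) p :
  (forall p, A p -> A (p *m S)) -> closure A p -> closure A (p *m S).
Proof.
move=> AS clp B pB; have [q [Aq Bq]] := clp _ (mulmx_continuous (S := S) pB).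
by exists (q *m S); split; [exact: AS|].
Qed.

Lemma rotational_symmetry c r u p q : hyp c -> 0 < r ->
  {within closure (hball_star c r), continuous u} ->
  C2_on (hball_star c r) u -> spacelike_translator (hball_star c r) u ->
  (exists k : R, forall p, hsphere c r p -> u p = k) ->
  closure (hball_star c r) p -> closure (hball_star c r) q ->
  hdist c p = hdist c q -> u p <= u q.
Proof.
move=> hc r0 cu CU TRu [k uk] clp clq pq.
set A := hball_star c r.
have Ah : A `<=` hyp by move=> x [[]].
have Ab : A `<=` hball c r by move=> x [].
have Uo x : (hproj @^-1` A) x -> nbhs x (hproj @^-1` A).
  by move=> Ux; apply: cone_hball_star => //; exact: ltW.
have [Kc Kb] := closure_hball_compact hc (ltW r0) Ab.
have [hp pr] := Kb p clp; have [hq qr] := Kb q clq.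
have [->//|npq] := eqVneq p q.
pose v := p - q; have v0 : lform v v != 0 by rewrite gt_eqF // lform_sub_gt0.
have HS := lreflect_lorentz v0; set S := lreflect v in HS.
have cS : c *m S = c.
  apply: lreflect_fix; rewrite /v lformBr.
  by have := ch_hdist hc hp; have := ch_hdist hc hq; rewrite pq; lra.
have pS : p *m S = q by apply: lreflect_swap => //; rewrite hp.1 hq.1.
have dS x : hdist c (x *m S) = hdist c x by rewrite -{1}cS hdist_lorentz.
have AS x : A x -> A (x *m S).
  move=> /hball_starP -/(_ hc (ltW r0))[hx x1 xr]; apply/hball_starP => //; first exact: ltW.
  have E : lform c (x *m S) = lform c x by rewrite -{1}cS lorentz_lform.
  by rewrite E; split=> //; exact: (lorentz_hyp HS hc hx cS).
have TR1 x : A x -> translator_at x (partial_grad (hext u) x) (hess (hext u) x).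
  exact: (translator_atP Ah Uo CU TRu).
have [C2 TR2] := translator_mul HS Ah Uo AS CU TR1.
have cS2 : {within closure A, continuous (fun x => u (x *m S))}.
  move/subspace_continuousP: (cu) => cu'.
  apply/subspace_continuousP => x Kx; have H := cu' _ (closure_mul AS Kx).
  move=> B /H; rewrite /= !nbhs_simpl /within /= => HB.
  have FF : Filter (nbhs x) := nbhs_filter x.
  apply: (@filterS _ (nbhs x) FF _ _ _ (mulmx_continuous (S := S) HB)) => y /= Hy Ky.
  exact: Hy (closure_mul AS Ky).
rewrite -pS; apply: (translator_comparison Ah Uo Kc (@subset_closure _ _) cu cS2 CU C2 TR1 TR2 _ clp).
(* A point of the closure outside [A] is either [c], fixed by [S], or on the sphere, where [u] is
   constant. The singularity is thus treated as a boundary point. *)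
move=> x Kx nAx; have [hx xr] := Kb x Kx.
have [xc|nxc] := eqVneq x c; first by rewrite xc cS.
have E : hdist c x = r.
  apply/eqP; rewrite eq_le xr leNgt; apply/negP => xr'; apply: nAx.
  by split; [split|move=> /= xc; rewrite xc eqxx in nxc].
rewrite !uk //; split=> //; first by have [] := Kb _ (closure_mul AS Kx).
by rewrite dS.
Qed.

End RotationalSymmetry.

(** * The radial profile along a geodesic and its differential equation *)

Section Profile.
Context {R : realType} {n : nat}.
Implicit Types (x y z p c : 'rV[R]_n.+1) (s t r : R).

Lemma lorentz_row (S : 'M[R]_n.+1) i j : lorentz S ->
  lform (row i S) (row j S) = if i == j then lsign i else 0.
Proof.
move=> HS; rewrite !rowE lorentz_lform // lformE -rowE trmx_delta -colE !mxE.
by case: eqVneq => _; rewrite ?mulr1n ?mulr0n.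
Qed.

Lemma is_derive_comb (a b : R -> R) t a' b' x y i :
  is_derive t 1 a a' -> is_derive t 1 b b' ->
  is_derive t 1 (fun s => (a s *: x + b s *: y) 0 i) ((a' *: x + b' *: y) 0 i).
Proof.
move=> da db.
have -> : (fun s => (a s *: x + b s *: y) 0 i) =
  (fun s => x 0 i * a s + y 0 i * b s).
  by apply/funext => s; rewrite !mxE; ring.
apply: (is_derive_eq (is_derive_add (is_derive_scale (x 0 i) da)
  (is_derive_scale (y 0 i) db))).
by rewrite !mxE; ring.
Qed.

Lemma is_derive_addl_coord (g : R -> 'rV[R]_n.+1) t z i (d : R) :
  is_derive t 1 (fun s => g s 0 i) d -> is_derive t 1 (fun s => (z + g s) 0 i) d.
Proof.
move=> dg; have -> : (fun s => (z + g s) 0 i) = (fun s => z 0 i + g s 0 i).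
  by apply/funext => s; rewrite mxE.
by apply: (is_derive_eq (is_derive_add (is_derive_cst1 (z 0 i) t) dg)); rewrite add0r.
Qed.

(** For a unit tangent vector [x] at [c] this is the unit speed geodesic, with velocity [geod'] and
    acceleration [geod] itself. Negative [s] is allowed, so the curve crosses [c]. *)
Definition geod c x s := ch s *: c + sh s *: x.
Definition geod' c x s := sh s *: c + ch s *: x.

Lemma is_derive_geod c x t i :
  is_derive t 1 (fun s => geod c x s 0 i) (geod' c x t 0 i).
Proof. exact: is_derive_comb (is_derive_ch t) (is_derive_sh t). Qed.

Lemma is_derive_geod' c x t i :
  is_derive t 1 (fun s => geod' c x s 0 i) (geod c x t 0 i).
Proof. exact: is_derive_comb (is_derive_sh t) (is_derive_ch t). Qed.

Lemma geod_continuous c x t : {for t, continuous (geod c x)}.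
Proof.
apply: differentiable_continuous; apply/derivable1_diffP/derivable_mxP => i j.
by rewrite ord1; have [] := is_derive_geod c x t j.
Qed.

Section Frame.
Variables (c : 'rV[R]_n.+1) (S : 'M[R]_n.+1) (i1 : 'I_n.+1).
Hypotheses (hc : hyp c) (HS : lorentz S) (Sc : row ord0 S = c) (i1_neq0 : i1 != ord0).
Let e := row i1 S.

Lemma lform_cc : lform c c = -1. Proof. exact: hc.1. Qed.

Lemma lform_crow k : k != ord0 -> lform c (row k S) = 0.
Proof. by move=> k0; rewrite -Sc lorentz_row // eq_sym (negPf k0). Qed.

Lemma lform_rowrow k : k != ord0 -> lform (row k S) (row k S) = 1.
Proof. by move=> k0; rewrite lorentz_row // eqxx /lsign (negPf k0). Qed.

Lemma lform_erow k : k != i1 -> lform e (row k S) = 0.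
Proof. by move=> k1; rewrite lorentz_row // eq_sym (negPf k1). Qed.

Lemma unit_comb_hyp (t a b : R) k : k != ord0 -> k != i1 -> a ^+ 2 + b ^+ 2 = 1 ->
  let p := ch t *: c + ((sh t * a) *: e + (sh t * b) *: row k S) in
  hyp p /\ lform c p = - ch t.
Proof.
move=> k0 k1 ab p.
have ce : lform c e = 0 by exact: lform_crow.
have ck := lform_crow k0; have ek := lform_erow k1.
have ee : lform e e = 1 by exact: lform_rowrow.
have kk := lform_rowrow k0.
have cp : lform c p = - ch t by rewrite /p !lform_lin lform_cc ce ck; ring.
split=> //; apply: (hyp_of_lform hc); last by rewrite lformC cp oppr_lt0 ch_gt0.
have cht := ch_sqr t.
rewrite /p !lform_lin (lformC e c) (lformC _ c) ce ck lform_cc ek (lformC (row k S) e) ek ee kk.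
transitivity (sh t ^+ 2 * (a ^+ 2 + b ^+ 2) - ch t ^+ 2); first by ring.
by rewrite ab cht; ring.
Qed.

Lemma geod_hyp s : hyp (geod c e s) /\ lform c (geod c e s) = - ch s.
Proof.
have ce : lform c e = 0 by exact: lform_crow.
have ee : lform e e = 1 by exact: lform_rowrow.
have cp : lform c (geod c e s) = - ch s.
  by rewrite /geod !lform_lin lform_cc ce; ring.
split=> //; apply: (hyp_of_lform hc); last by rewrite lformC cp oppr_lt0 ch_gt0.
rewrite /geod !lform_lin (lformC e c) ce lform_cc ee.
by transitivity (sh s ^+ 2 - ch s ^+ 2); [ring|rewrite ch_sqr; ring].
Qed.

Lemma hdist_geod s : 0 <= s -> hdist c (geod c e s) = s.
Proof. by move=> s0; rewrite /hdist (geod_hyp s).2 opprK arcosh_ch. Qed.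

Lemma hdist_geodN s : hdist c (geod c e (- s)) = hdist c (geod c e s).
Proof. by rewrite /hdist !(geod_hyp _).2 chN. Qed.

Lemma geod_ball r s : 0 <= r -> `|s| < r -> hball c r (geod c e s).
Proof.
move=> r0 sr; split; first exact: (geod_hyp s).1.
move: sr; have [s0|s0] := ger0P s => sr; first by rewrite hdist_geod.
by rewrite -(opprK s) hdist_geodN hdist_geod // oppr_ge0 ltW.
Qed.

Lemma geod_star r s : 0 <= r -> `|s| < r -> s != 0 -> hball_star c r (geod c e s).
Proof.
move=> r0 sr s0; split; first exact: geod_ball.
move=> /= E; have := (geod_hyp s).2; rewrite E lform_cc => /eqP.
rewrite eqr_opp => /eqP E1; have := ch_sqr s; rewrite -E1 expr1n => /eqP.
rewrite -subr_eq0 opprD addrA subrr sub0r oppr_eq0 sqrf_eq0.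
have [sp|sn|s00] := ltgtP s 0; last by rewrite s00 eqxx in s0.
  have := sh_gt0 (s := - s); rewrite oppr_gt0 => /(_ sp); rewrite shN => H /eqP E2.
  by rewrite E2 oppr0 ltxx in H.
by rewrite gt_eqF // sh_gt0.
Qed.

(** The boost in the plane of [c] and [e] carries the frame at [c] to one at [geod c e s]: the
    velocity replaces [e] and the other space vectors stay. *)
Lemma geod_tmetric s : tmetric (geod c e s) =
  (geod' c e s)^T *m geod' c e s +
  \sum_(k | (k != ord0) && (k != i1)) (row k S)^T *m row k S.
Proof.
have := tmetric_sum HS; rewrite Sc (bigD1 i1) //= -/e.
have : (geod c e s)^T *m geod c e s =
    (geod' c e s)^T *m geod' c e s + c^T *m c - e^T *m e.
  have cht := ch_sqr s; rewrite /geod /geod'; move: e => f.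
  apply/matrixP => i j; rewrite !mxE !big_ord1 !mxE; move: cht.
  move: (c 0 i) (c 0 j) (f 0 i) (f 0 j) (ch s) (sh s) => x1 x2 x3 x4 y1 y2 cht.
  apply: subr0_eq; transitivity ((y1 ^+ 2 - (1 + y2 ^+ 2)) * (x1 * x2 - x3 * x4)).
    by ring.
  by rewrite cht subrr mul0r.
rewrite /tmetric.
move: (\sum_(k | _) _) ((geod c e s)^T *m geod c e s) ((geod' c e s)^T *m geod' c e s)
  (c^T *m c) (e^T *m e) => X Y Y' Z W -> /matrixP H.
by apply/matrixP => i j; have := H i j; rewrite !mxE; lra.
Qed.

Section ProfileEquation.
Variables (r : R) (u : 'rV[R]_n.+1 -> R).
Hypothesis r_gt0 : 0 < r.
Let F := hext u.
Let phi s := F (geod c e s).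
Let phi1 s := (geod' c e s *m partial_grad F (geod c e s)) 0 0.

(** The acceleration term drops out because it is radial. The domain is left general: the punctured
    ball serves for the equation, the full ball for the behavior at the center. *)
Lemma profile_derive (A : set 'rV[R]_n.+1) s :
  (forall x, (hproj @^-1` A) x -> nbhs x (hproj @^-1` A)) ->
  C2_on A u -> A (geod c e s) ->
  is_derive s 1 phi (phi1 s) /\ is_derive s 1 phi1
    ((geod' c e s *m hess F (geod c e s) *m (geod' c e s)^T) 0 0).
Proof.
move=> Uo CU Ap; have hp := (geod_hyp s).1.
have Up : (hproj @^-1` A) (geod c e s) by rewrite /= hproj_id.
split; first by apply: (C1_chain CU.1 (Uo _ Up)) => i; exact: is_derive_geod.
have [pg _] := hext_radial Uo CU Up.
apply: (is_derive_eq (C2_chain CU (Uo _ Up) (is_derive_geod c e s) (is_derive_geod' c e s))).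
by rewrite pg add0r.
Qed.

Hypothesis CU : C2_on (hball_star c r) u.
Hypothesis TR : forall p, hball_star c r p ->
  translator_at p (partial_grad (hext u) p) (hess (hext u) p).
Hypothesis rot : forall p q, hball_star c r p -> hball_star c r q ->
  hdist c p = hdist c q -> u p = u q.

Let Uo x : (hproj @^-1` hball_star c r) x -> nbhs x (hproj @^-1` hball_star c r).
Proof. by move=> Ux; apply: cone_hball_star => //; exact: ltW. Qed.

(* [u] is constant on the circle [t |-> ch s c + sh s (cos t e + sin t f)]. *)
Lemma profile_orthogonal s k : 0 < s < r -> k != ord0 -> k != i1 ->
  (row k S *m partial_grad F (geod c e s)) 0 0 = 0 /\
  (row k S *m hess F (geod c e s) *m (row k S)^T) 0 0 = coth s * phi1 s.
Proof.
move=> /andP[s0 sr] k0 k1; set f := row k S.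
have shs : sh s != 0 by rewrite gt_eqF // sh_gt0.
pose C t := ch s *: c + ((sh s * cos t) *: e + (sh s * sin t) *: f).
pose C1 t := ((- sh s * sin t) *: e + (sh s * cos t) *: f).
have hC t : hyp (C t) /\ lform c (C t) = - ch s.
  by apply: unit_comb_hyp => //; exact: cos2Dsin2.
have sp : hball_star c r (geod c e s).
  by apply: geod_star; [exact: ltW|rewrite gtr0_norm|rewrite gt_eqF].
have [hp cp] := geod_hyp s.
have inC t : hball_star c r (C t).
  apply/hball_starP => //; first exact: ltW.
  move/(hball_starP _ hc (ltW r_gt0)): sp; rewrite cp => -[_ s1 s2].
  by rewrite (hC t).2; split=> //; exact: (hC t).1.
have UC t : nbhs (C t) (hproj @^-1` hball_star c r).
  by apply: Uo; rewrite /= hproj_id; [exact: inC|exact: (hC t).1].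
have FC t : F (C t) = u (geod c e s).
  rewrite /F hext_hyp; last exact: (hC t).1.
  by apply: rot => //; rewrite /hdist (hC t).2 cp.
have C0 : C 0 = geod c e s.
  by rewrite /C /geod cos0 sin0 mulr1 mulr0 scale0r addr0.
have C10 : C1 0 = sh s *: f.
  by rewrite /C1 cos0 sin0 mulr1 mulr0 scale0r add0r.
have dcos t : is_derive t 1 (fun t => sh s * cos t) (- sh s * sin t).
  by apply: (is_derive_eq (is_derive_scale (sh s) (is_derive_cos t))); ring.
have dsin t : is_derive t 1 (fun t => sh s * sin t) (sh s * cos t).
  exact: (is_derive_scale (sh s) (is_derive_sin t)).
have dNsin t : is_derive t 1 (fun t => - sh s * sin t) (- sh s * cos t).
  exact: (is_derive_scale (- sh s) (is_derive_sin t)).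
have dC t i : is_derive t 1 (fun t => C t 0 i) (C1 t 0 i).
  exact: is_derive_addl_coord (is_derive_comb e f i (dcos t) (dsin t)).
have dC1 i : is_derive (0 : R) 1 (fun t => C1 t 0 i) ((- sh s *: e) 0 i).
  have := is_derive_comb e f i (dNsin 0) (dcos 0).
  by rewrite cos0 sin0 mulr1 mulr0 scale0r addr0.
have D1 t : (C1 t *m partial_grad F (C t)) 0 0 = 0.
  apply: (is_derive_const_near (e := 1) ltr01 _ (C1_chain CU.1 (UC t) (dC t))).
  by move=> s' _; exact: FC.
have fg : (f *m partial_grad F (geod c e s)) 0 0 = 0.
  have := D1 0; rewrite C0 C10 -scalemxAl mxE => /eqP.
  by rewrite mulf_eq0 (negPf shs) => /eqP.
split=> //.
have D2 : (- sh s *: e *m partial_grad F (geod c e s)) 0 0 +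
    (sh s *: f *m hess F (geod c e s) *m (sh s *: f)^T) 0 0 = 0.
  have := C2_chain CU (UC 0) (dC 0) dC1; rewrite C0 C10.
  move=> H; apply: (is_derive_const_near (e := 1) ltr01 _ H).
  by move=> s' _; exact: D1.
have [pg _] := hext_radial Uo CU (nbhs_singleton (UC 0)); rewrite C0 in pg.
(* The acceleration of the circle points along [e = ch s geod' - sh s geod], and the gradient
   vanishes on the [geod] part. *)
have eg : (e *m partial_grad F (geod c e s)) 0 0 = ch s * phi1 s.
  have -> : e = ch s *: geod' c e s - sh s *: geod c e s.
    rewrite /geod /geod'; have cht := ch_sqr s; move: e => g.
    apply/rowP => i; rewrite !mxE.
    transitivity (ch s ^+ 2 * g 0 i - sh s ^+ 2 * g 0 i); first by rewrite cht; ring.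
    by ring.
  move: pg; rewrite mulmxBl -!scalemxAl /phi1.
  have -> : ch s *: geod' c e s - sh s *: geod c e s = e.
    rewrite /geod /geod'; have cht := ch_sqr s; move: e => g.
    apply/rowP => i; rewrite !mxE.
    transitivity (ch s ^+ 2 * g 0 i - sh s ^+ 2 * g 0 i); first by ring.
    by rewrite cht; ring.
  move: (geod c e s *m _) (geod' c e s *m _) => x y x0.
  by rewrite !mxE x0 mulr0 subr0.
move: D2; rewrite quad_formZ -scalemxAl mxE eg cothE => D2.
apply: (mulfI (x := sh s ^+ 2)); first by rewrite expf_neq0.
transitivity (sh s * (ch s * phi1 s)); first by move: D2; rewrite mulNr; lra.
by field.
Qed.

(** The gradient points along the geodesic, so [N = phi1^2] and [Q = phi1^2 phi2]. Hence
    [(1 - N) phi2 + Q = phi2], and the equation is already solved for the second derivative. *)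
Lemma profile_equation s : 0 < s < r ->
  phi1 s ^+ 2 < 1 /\
  is_derive s 1 phi1 ((1 - phi1 s ^+ 2) * (1 - (n%:R - 1) * coth s * phi1 s)).
Proof.
move=> sI; have /andP[s0 sr] := sI.
have sp : hball_star c r (geod c e s).
  by apply: geod_star; [exact: ltW|rewrite gtr0_norm|rewrite gt_eqF].
have [_ D] := profile_derive Uo CU sp.
set g := partial_grad F (geod c e s); set B := hess F (geod c e s) in D *.
set v := geod' c e s in D *.
set phi2 := (v *m B *m v^T) 0 0 in D.
have vg : v *m g = (phi1 s)%:M by rewrite [LHS]mx11_scalar.
set M := tmetric (geod c e s).
have Mg : M *m g = phi1 s *: v^T.
  rewrite /M geod_tmetric mulmxDl -mulmxA vg mul_mx_scalar mulmx_suml.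
  rewrite big1 ?addr0 // => k /andP[k0 k1].
  rewrite -mulmxA [row k S *m g]mx11_scalar (profile_orthogonal sI k0 k1).1.
  by rewrite mul_mx_scalar scale0r.
have trE : \tr (M *m B) = phi2 + (n%:R - 1) * (coth s * phi1 s).
  rewrite /M geod_tmetric mulmxDl raddfD /=; congr (_ + _).
    by rewrite -mulmxA mxtrace_mulC [X in \tr X]mx11_scalar mxtrace_scalar mulr1n.
  rewrite mulmx_suml raddf_sum /=.
  rewrite (eq_bigr (fun=> coth s * phi1 s)); last first.
    move=> k /andP[k0 k1]; rewrite -mulmxA mxtrace_mulC.
    by rewrite [X in \tr X]mx11_scalar mxtrace_scalar mulr1n (profile_orthogonal sI k0 k1).2.
  rewrite sumr_const -[_ *+ _]mulr_natl; congr (_ * _).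
  (* The [n.+1] frame vectors without the time vector and [e] are [n - 1] in number; the successor
     avoids truncated subtraction. *)
  have E : (#|[pred k : 'I_n.+1 | (k != ord0) && (k != i1)]|.+1 = n)%N.
    have := cardC [pred k : 'I_n.+1 | (k == ord0) || (k == i1)].
    rewrite card_ord (eq_card (B := pred2 ord0 i1)) // card2 eq_sym i1_neq0.
    by rewrite (eq_card (A := predC _) (B := [pred k : 'I_n.+1 | (k != ord0) && (k != i1)])) => [[]|k];
      rewrite // !inE negb_or.
  by rewrite -[in RHS]E -natr1 addrK.
have QE : ((M *m g)^T *m B *m (M *m g)) 0 0 = phi1 s ^+ 2 * phi2.
  rewrite Mg (_ : phi1 s *: v^T = (phi1 s *: v)^T); last by rewrite linearZ.
  by rewrite trmxK quad_formZ.
have NE : (g^T *m M *m g) 0 0 = phi1 s ^+ 2.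
  rewrite -mulmxA Mg -scalemxAr -trmx_mul vg tr_scalar_mx scale_scalar_mx mxE.
  by rewrite eqxx mulr1n expr2.
have [N1 EQ] := TR sp; rewrite -/M -/F -/g -/B NE trE QE in N1 EQ.
split=> //; apply: (is_derive_eq D).
by rewrite mulrBr mulr1 -[LHS]/phi2 -mulrA; lra.
Qed.

End ProfileEquation.
End Frame.
End Profile.

(** * Uniqueness for the bowl equation and integration of its solution *)

Section Bowl.
Context {R : realType}.
Implicit Types (s t x y : R) (w phi : R -> R).

(* Twice the inverse hyperbolic tangent. *)
Definition lnratio x : R := ln (1 + x) - ln (1 - x).

Lemma is_derive_lnratio x : -1 < x < 1 -> is_derive x 1 lnratio (2 / (1 - x ^+ 2)).
Proof.
move=> /andP[x1 x2]; have p1 : 0 < 1 + x by lra. have p2 : 0 < 1 - x by lra.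
have d1 := is_derive_comp (is_derive1_ln p1)
  (is_derive_add (is_derive_cst1 1 x) (is_derive_id1 x)).
have d2 := @is_derive_comp R (@ln R) (fun s => 1 - s) x _ _ (is_derive1_ln p2)
  (is_derive_sub (is_derive_cst1 1 x) (is_derive_id1 x)).
apply: (is_derive_eq (is_derive_sub d1 d2)).
have -> : 1 - x ^+ 2 = (1 + x) * (1 - x) by ring.
by field; rewrite !gt_eqF.
Qed.

Lemma ltr_lnratio x y : -1 < x < 1 -> -1 < y < 1 -> x < y -> lnratio x < lnratio y.
Proof.
move=> /andP[x1 x2] /andP[y1 y2] xy; rewrite /lnratio ltrB // ltr_ln ?posrE; lra.
Qed.

Lemma lnratio_mono x y : -1 < x < 1 -> -1 < y < 1 ->
  0 <= (lnratio x - lnratio y) * (x - y).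
Proof.
move=> hx hy; have [xy|yx|->] := ltgtP x y; last by rewrite !subrr mul0r.
  have := ltr_lnratio hx hy xy => H.
  by apply: mulr_le0; rewrite subr_le0 ltW.
have := ltr_lnratio hy hx yx => H.
by apply: mulr_ge0; rewrite subr_ge0 ltW.
Qed.

Lemma lnratio_inj x y : -1 < x < 1 -> -1 < y < 1 -> lnratio x = lnratio y -> x = y.
Proof.
move=> hx hy E; have [xy|yx|//] := ltgtP x y.
  by have := ltr_lnratio hx hy xy; rewrite E ltxx.
by have := ltr_lnratio hy hx yx; rewrite E ltxx.
Qed.

(** The equation is singular at 0, but with a favorable sign: [lnratio] cancels the factor
    [1 - w^2], and the difference [d] satisfies [d' = - 2 m coth (w1 - w2)], whose sign is opposite
    to that of [d]. *)
Lemma profile_unique (m t : R) (w1 w2 : R -> R) : 0 <= m -> 0 < t ->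
  {within `[0, t], continuous w1} -> {within `[0, t], continuous w2} ->
  w1 0 = w2 0 ->
  (forall s, 0 <= s <= t -> -1 < w1 s < 1 /\ -1 < w2 s < 1) ->
  (forall s, 0 < s < t ->
    is_derive s 1 w1 ((1 - w1 s ^+ 2) * (1 - m * coth s * w1 s)) /\
    is_derive s 1 w2 ((1 - w2 s ^+ 2) * (1 - m * coth s * w2 s))) ->
  w1 t = w2 t.
Proof.
move=> m0 t0 c1 c2 w0 wb dw.
pose d s := lnratio (w1 s) - lnratio (w2 s).
pose h s := d s * d s.
pose h' s := 2 * d s * (- (2 * m * coth s * (w1 s - w2 s))).
have lc (f : R -> R) : {within `[0, t], continuous f} ->
   (forall s, 0 <= s <= t -> -1 < f s < 1) ->
   {within `[0, t], continuous (lnratio \o f)}.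
  move=> cf fb; apply: within_continuous_comp => // y.
  rewrite inE /= => -[s]; rewrite in_itv /= => /fb fs <-.
  apply: differentiable_continuous; apply/derivable1_diffP.
  by have [] := is_derive_lnratio fs.
have cl1 := lc _ c1 (fun s hs => (wb s hs).1).
have cl2 := lc _ c2 (fun s hs => (wb s hs).2).
have cdd : {within `[0, t], continuous (fun s => (lnratio \o w1) s - (lnratio \o w2) s)}.
  by move=> s; apply: continuousB; [exact: cl1|exact: cl2].
have ch : {within `[0, t], continuous h}.
  have -> : h = (fun s => ((fun s => (lnratio \o w1) s - (lnratio \o w2) s) s) *
     ((fun s => (lnratio \o w1) s - (lnratio \o w2) s) s)) by [].
  by move=> s; apply: (continuousM (cdd s) (cdd s)).
have dh s : s \in `]0, t[ -> is_derive s 1 h (h' s).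
  rewrite in_itv /= => st; have /andP[s0 st'] := st.
  have [b1 b2] : -1 < w1 s < 1 /\ -1 < w2 s < 1 by apply: wb; rewrite !ltW.
  have [d1 d2] := dw s st.
  have e1 := is_derive_comp (is_derive_lnratio b1) d1.
  have e2 := is_derive_comp (is_derive_lnratio b2) d2.
  have e12 := is_derive_sub e1 e2.
  apply: (is_derive_eq (is_derive_mul e12 e12)).
  have n1 : 1 - w1 s ^+ 2 != 0 by move: b1; rewrite subr_eq0 => b1; rewrite gt_eqF //; nra.
  have n2 : 1 - w2 s ^+ 2 != 0 by move: b2; rewrite subr_eq0 => b2; rewrite gt_eqF //; nra.
  rewrite /h' /d; move: (lnratio _) (lnratio _) => l1 l2.
  by field; rewrite n1 n2.
(* The mean value theorem needs only continuity at 0, so [coth] is evaluated at an interior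
   point. *)
have [x] := MVT t0 dh ch.
rewrite in_itv /= => /andP[x0 xt] E.
have [b1 b2] : -1 < w1 x < 1 /\ -1 < w2 x < 1 by apply: wb; rewrite !ltW.
have ct : 0 < coth x by rewrite cothE divr_gt0 ?ch_gt0 // sh_gt0.
have h0 : h 0 = 0 by rewrite /h /d w0 subrr mul0r.
have : h t <= 0.
  have -> : h t = h' x * t by move: E; rewrite h0 !subr0.
  apply: mulr_le0_ge0; last exact: ltW.
  have -> : h' x = - (4 * (m * coth x) * (d x * (w1 x - w2 x))) by rewrite /h'; ring.
  rewrite oppr_le0 mulr_ge0 //; last exact: lnratio_mono.
  by rewrite mulr_ge0 // mulr_ge0 // ltW.
move=> ht; have [b1t b2t] : -1 < w1 t < 1 /\ -1 < w2 t < 1.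
  by apply: wb; rewrite lexx ltW.
apply: lnratio_inj => //; apply/eqP; rewrite -subr_eq0 -/(d t).
have : h t == 0 by rewrite eq_le ht /h -expr2 sqr_ge0.
by rewrite /h mulf_eq0 orbb.
Qed.

Lemma bowl_fun_primitive w phi (f0 s : R) : 0 < s ->
  {within `[0, s], continuous w} -> derivable_oo_LRcontinuous phi 0 s ->
  (forall t, 0 < t < s -> is_derive t 1 phi (w t)) ->
  bowl_fun w f0 s = phi s - phi 0 + f0.
Proof.
move=> s0 cw dphi phiw; rewrite /bowl_fun /Rintegral.
rewrite (continuous_FTC2 s0 cw dphi) ?fine_EFin // => t; rewrite in_itv /= => ts.
by rewrite derive1E; have [_ ->] := phiw t ts.
Qed.

Lemma bowl_fun0 w (f0 : R) : bowl_fun w f0 0 = f0.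
Proof. by rewrite /bowl_fun set_itv1 Rintegral_set1 add0r. Qed.

End Bowl.

(** * Symmetry on the closed ball and identification with the bowl *)

Theorem corollary5p3 (R : realType) (n : nat) (c : 'rV[R]_n.+1) (r : R)
    (u : 'rV[R]_n.+1 -> R)
    (n_ge2 : (2 <= n)%N) (c_hyp : hyp c) (r_gt0 : 0 < r)
    (u_C0 : {within closure (hball_star c r), continuous u})
    (u_C2 : C2_on (hball_star c r) u)
    (u_translator : spacelike_translator (hball_star c r) u)
    (u_boundary : exists k : R, forall p, hsphere c r p -> u p = k) :
  rotationally_invariant c (closure (hball_star c r)) u /\
  (C2_on (hball c r) u ->
   forall w : R -> R, bowl_profile n w ->
   exists f0 : R, forall p, closure (hball c r) p ->
     u p = bowl_fun w f0 (hdist c p)).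
Proof.
set A := hball_star c r.
have r_ge0 := ltW r_gt0.
have Ah : A `<=` hyp by move=> x [[]].
have Ab : A `<=` hball c r by move=> x [].
have AK : A `<=` closure A by exact: subset_closure.
have rot p q : closure A p -> closure A q -> hdist c p = hdist c q -> u p = u q.
  move=> Kp Kq pq; apply/eqP; rewrite eq_le.
  by rewrite !(rotational_symmetry c_hyp r_gt0 u_C0 u_C2 u_translator u_boundary).
split.
  (* The profile evaluates [u] at a chosen point at distance [s]; [c] is the default for distances
     that do not occur. *)
  exists (fun s => u (xget c [set p | closure A p /\ hdist c p = s])) => p Kp.
  have [Kq cq] := @xgetPex _ c [set q | closure A q /\ hdist c q = hdist c p]
    (ex_intro _ p (conj Kp erefl)).
  by apply: rot.
move=> u_C2b w [w_cont w_bound w_0 w_ode].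
have [S HS Sc] := hyp_frame c_hyp.
have i1P : (1 < n.+1)%N by rewrite ltnS (leq_trans _ n_ge2).
pose i1 : 'I_n.+1 := Ordinal i1P.
have i10 : i1 != ord0 by [].
pose gam := geod c (row i1 S).
have gam0 : gam 0 = c by rewrite /gam /geod ch0 sh0 scale1r scale0r addr0.
have gam_hyp s : hyp (gam s) by exact: (geod_hyp c_hyp HS Sc i10 s).1.
have gam_dist s : 0 <= s -> hdist c (gam s) = s.
  exact: (hdist_geod c_hyp HS Sc i10).
have gam_cont s : {for s, continuous gam} by exact: geod_continuous.
have gam_star s : `|s| < r -> s != 0 -> A (gam s).
  by move=> *; apply: (geod_star c_hyp HS Sc i10).
have gam_ball s : `|s| < r -> hball c r (gam s).
  by move=> *; apply: (geod_ball c_hyp HS Sc i10).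
have Uob x : (hproj @^-1` hball c r) x -> nbhs x (hproj @^-1` hball c r).
  by move=> Ux; apply: cone_hball.
have Uo x : (hproj @^-1` A) x -> nbhs x (hproj @^-1` A).
  by move=> Ux; apply: cone_hball_star.
have TR x : A x -> translator_at x (partial_grad (hext u) x) (hess (hext u) x).
  exact: (translator_atP Ah Uo u_C2 u_translator).
have rotA p q : A p -> A q -> hdist c p = hdist c q -> u p = u q.
  by move=> /AK Kp /AK Kq; exact: rot.
pose phi s := hext u (gam s).
pose phi1 s := (geod' c (row i1 S) s *m partial_grad (hext u) (gam s)) 0 0.
have phiE s : phi s = u (gam s) by exact: hext_hyp.
have dphi (s : R) : `|s| < r -> is_derive s 1 phi (phi1 s).
  by move=> sr; exact: (profile_derive c_hyp HS Sc i10 Uob u_C2b (gam_ball s sr)).1.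
have dphi1 (s : R) : `|s| < r -> derivable phi1 s 1.
  move=> sr.
  by have [_ []] := profile_derive c_hyp HS Sc i10 Uob u_C2b (gam_ball s sr).
(* The geodesic runs through [c] and [phi] is even on it, so [phi s - phi (- s)] is constant while
   its derivative at 0 is [2 phi1 0]. *)
have phi1_0 : phi1 0 = 0.
  have z0 : `|0 : R| < r by rewrite normr0.
  have dN : is_derive (0 : R) 1 (fun s => - s) (-1).
    exact: is_deriveNid.
  have H1 : is_derive (0 : R) 1 (fun s => phi (- s)) (phi1 0 * -1).
    by apply: (@is_derive_comp R phi (fun s => - s) 0 _ _ _ dN); rewrite oppr0; exact: dphi.
  have H := is_derive_sub (dphi 0 z0) H1.
  have : phi1 0 - phi1 0 * -1 = 0.
    apply: (is_derive_const_near (k := 0) r_gt0 _ H) => s; rewrite subr0 => sr.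
    rewrite !phiE; have [->|s0] := eqVneq s 0; first by rewrite oppr0 subrr.
    apply/eqP; rewrite subr_eq0; apply/eqP; apply: rotA; first exact: gam_star.
      by apply: gam_star; rewrite ?normrN ?oppr_eq0.
    exact: esym (hdist_geodN c_hyp HS Sc i10 s).
  by lra.
have phi1_eq s : 0 < s < r -> phi1 s ^+ 2 < 1 /\
    is_derive s 1 phi1 ((1 - phi1 s ^+ 2) * (1 - (n%:R - 1) * coth s * phi1 s)).
  exact: (profile_equation c_hyp HS Sc i10 r_gt0 u_C2 TR rotA).
have phi1w t : 0 < t < r -> phi1 t = w t.
  move=> /andP[t0 tr]; apply: (@profile_unique R (n%:R - 1)) => //.
  - by rewrite subr_ge0 ler1n (leq_trans _ n_ge2).
  - apply: derivable_within_continuous => s; rewrite in_itv /= => /andP[s0 st].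
    by apply: dphi1; rewrite ger0_norm // (le_lt_trans st).
  - apply: continuous_subspaceW w_cont => s /=; rewrite !in_itv /= andbT.
    by move=> /andP[].
  - by rewrite phi1_0 w_0.
  - move=> s /andP[s0 st]; split; last exact: w_bound.
    move: s0; rewrite le_eqVlt => /orP[/eqP <-|s0].
      by rewrite phi1_0 ltrN10 ltr01.
    have [H _] := phi1_eq s (introT andP (conj s0 (le_lt_trans st tr))).
    by rewrite -ltr_norml -(@expr_lt1 _ 2) // real_normK ?num_real.
  - move=> s /andP[s0 st]; split; last exact: w_ode.
    by apply: (phi1_eq s _).2; rewrite s0 (lt_trans st).
(* The case [s = r] is the one that matters: a point of the sphere is a limit of points slightly
   closer to [c] on the same geodesic. *)
have gam_closure s : 0 < s <= r -> closure A (gam s).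
  move=> /andP[s0 sr] B Bs.
  have /nbhs_ballP[d /= d0 dB] := gam_cont s B Bs.
  pose m := Num.min s d / 2.
  have m0 : 0 < Num.min s d by rewrite lt_min s0.
  have [ms md] : m < s /\ m < d.
    have : m < Num.min s d by rewrite /m; lra.
    by rewrite lt_min => /andP.
  have mp : 0 < m by rewrite /m; lra.
  exists (gam (s - m)); split.
    apply: gam_star; first by rewrite gtr0_norm; lra.
    by rewrite gt_eqF //; lra.
  by apply: dB; rewrite -ball_normE /ball_ /= opprB addrCA subrr addr0 gtr0_norm.
have main s : 0 < s <= r -> u (gam s) = bowl_fun w (u c) s.
  move=> sI; have /andP[s0 sr] := sI.
  have phiw (t : R) : 0 < t < s -> is_derive t 1 phi (w t).
    move=> /andP[t0 ts]; rewrite -phi1w ?t0 ?(lt_le_trans ts) //.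
    by apply: dphi; rewrite gtr0_norm // (lt_le_trans ts).
  rewrite (@bowl_fun_primitive R w phi) //.
  - by rewrite !phiE gam0 subrK.
  - apply: continuous_subspaceW w_cont => t /=; rewrite !in_itv /= andbT.
    by move=> /andP[].
  split.
  - by move=> t; rewrite in_itv /= => ts; have [] := phiw t ts.
  - apply: cvg_at_right_filter.
    have z0 : `|0 : R| < r by rewrite normr0.
    have [D _] := dphi 0 z0.
    by apply: differentiable_continuous; apply/derivable1_diffP.
  (* For [s = r] no derivative is available at the right end; the left limit of [phi] comes from the
     continuity of [u] on the closure. *)
  - move/subspace_continuousP: (u_C0) => u_C0'.
    move=> B; rewrite phiE => HB; have := u_C0' _ (gam_closure s sI) B HB.
    rewrite /within /= => /(gam_cont s) H0.
    have H : nbhs s (gam @^-1` [set y | closure A y -> B (u y)]) := H0.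
    have N0 : nbhs s [set t | 0 < t] := lt_nbhsr s0.
    apply: (@filterS _ (nbhs s) (nbhs_filter s) _ _ _ (filterI H N0)) => t [Ht t0] ts /=.
    have t_gt0 : 0 < t := t0.
    rewrite phiE; apply: Ht; apply: AK; apply: gam_star; last by rewrite gt_eqF.
    by rewrite gtr0_norm //; exact: lt_le_trans ts sr.
exists (u c) => p Kp.
have [_ Kb] := closure_hball_compact c_hyp r_ge0 (@subset_refl _ (hball c r)).
have [hp pr] := Kb p Kp.
have [pc|npc] := eqVneq (hdist c p) 0.
  by rewrite pc bowl_fun0 -(hdist_eq0 c_hyp hp pc).
have s0 : 0 < hdist c p by rewrite lt_neqAle eq_sym npc hdist_ge0.
have sI : 0 < hdist c p <= r by rewrite s0.
rewrite -main //; apply: rot; last by rewrite gam_dist // ltW.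
  (* Here [p] is in the closure of the full ball, while [rot] concerns the punctured one; the
     condition [<c, .> < -1] defines a neighborhood of [p] that avoids [c]. *)
  have cp : lform c p < -1.
    by have := ch_hdist c_hyp hp; have := ltr_ch (lexx 0) (ltW s0); rewrite s0 ch0; lra.
  move=> B pB; have N := near_lt (@lform_continuous _ _ c p) cp.
  have [q [Aq [Bq qc]]] := Kp _ (filterI pB N).
  exists q; split=> //; split=> //= qE.
  by move: qc; rewrite /= qE c_hyp.1 ltxx.
exact: gam_closure.
Qed.
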